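(* (1) The triple $(\mathcal{T}_\bullet,\overline{\ast},\hat{\delta})$ is a graded connected cocommutative Hopf algebra (with unit the empty set composition and counit the projection onto $\mathcal{T}_0$). (2) The triple $(\mathcal{T}_\bullet,\hat{\ast},\overline{\delta})$ is a graded connected Hopf algebra, and it is isomorphic to the graded dual $\mathsf{NCQsym}^*$ of the Hopf algebra $\mathsf{NCQsym}$ of quasi-symmetric functions in non-commuting variables; an isomorphism is given by sending each set composition $P$ to the element $W_P$ of the basis of $\mathsf{NCQsym}^*$ dual to the basis $(M_P)$ of $\mathsf{NCQsym}$.
   Context: For a finite set $S\subset\mathbb{N}$, a set composition of $S$ is a tuple $(P_1,\ldots,P_k)$ of pairwise disjoint non-empty subsets of $S$ with union $S$; $\mathsf{Comp}_n$ is the set of set compositions of $[n]=\{1,\ldots,n\}$ ($[0]=\emptyset$, $\mathsf{Comp}_0$ consists of the empty tuple). $\mathcal{T}_n$ is the free $\mathbb{Z}$-module on $\mathsf{Comp}_n$ and $\mathcal{T}_\bullet=\bigoplus_{n\ge0}\mathcal{T}_n$, graded by $n$. For finite $S,T\subset\mathbb{N}$ with $|S|=|T|$, $\mathsf{is}_{S,T}$ maps a set composition of $S$ to a set composition of $T$ by applying the unique order-preserving bijection $S\to T$ to each block; $\mathsf{is}_S=\mathsf{is}_{S,[|S|]}$. For $P=(P_1,\ldots,P_k)\in\mathsf{Comp}_n$ and $A\subseteq[n]$, $P|_A=\mathsf{is}_A((P_1\cap A,\ldots,P_k\cap A)^\#)$, where $^\#$ deletes empty entries. For set compositions $P$ of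 $S$ and $Q$ of $T$ with $S\cap T=\emptyset$, $P\ast Q$ is the concatenated tuple. Write $p+X=\{p+x:x\in X\}$. Products and coproducts (extended linearly): for $P=(P_1,\ldots,P_k)\in\mathsf{Comp}_p$, $Q=(Q_1,\ldots,Q_l)\in\mathsf{Comp}_q$: $P\,\overline{\ast}\,Q=(P_1,\ldots,P_k,p+Q_1,\ldots,p+Q_l)$; $P\,\hat{\ast}\,Q=\sum \mathsf{is}_{[p],A}(P)\ast\mathsf{is}_{[q],B}(Q)$, summed over all ordered pairs $(A,B)$ with $A\sqcup B=[p+q]$, $|A|=p$, $|B|=q$. For $P\in\mathsf{Comp}_n$: $\hat{\delta}(P)=\sum_{A\sqcup B=[n]}P|_A\otimes P|_B$ (over ordered pairs, $A$ or $B$ possibly empty) and $\overline{\delta}(P)=\sum_{p+q=n}P|_{[p]}\otimes P|_{\{p+1,\ldots,p+q\}}$. $\mathsf{NCQsym}$: in the algebra of formal power series in non-commuting variables $x_1,x_2,\ldots$, for $P=(P_1,\ldots,P_k)\in\mathsf{Comp}_n$ let $M_P=\sum x_{i_1}\cdots x_{i_n}$, summed over all words with $i_j=i_{j'}$ iff $j,j'$ lie in the same block and $i_j<i_{j'}$ whenever $j\in P_r$, $j'\in P_s$, $r<s$. $\mathsf{NCQsym}$ is the graded span of the $M_P$, with the product of series and the coproduct $\Delta(M_P)=\sum_{i=0}^k M_{\mathsf{is}(P_1,\ldots,P_i)}\otimes M_{\mathsf{is}(P_{i+1},\ldots,P_k)}$ ($\mathsf{is}$ standardizing the ground set to an initial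 segment); $\mathsf{NCQsym}^*$ is its graded dual with dual basis $(W_P)$. *)

(* Defs.v *)
From HB Require Import structures.
From mathcomp Require Import all_boot all_algebra.
From mathcomp Require Import finmap.
Set Implicit Arguments. Unset Strict Implicit. Unset Printing Implicit Defensive.
Import GRing.Theory.
Local Open Scope fset_scope.
Local Open Scope ring_scope.

(* An element of the free Z-module on a type T is represented by a finite
   formal sum [:: (c1, t1); ...; (ck, tk)]; two formal sums denote the same
   element iff all their coefficients agree ([feq]). *)
Definition fsum (T : Type) := seq (int * T).
Definition coef {T : eqType} (x : fsum T) (t : T) : int :=
  \sum_(p <- x | p.2 == t) p.1.
Definition feq {T : eqType} (x y : fsum T) : Prop := forall t, coef x t = coef y t.
Definition fsingle {T : Type} (t : T) : fsum T := [:: (1%:Z, t)].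
Definition fscale {T : Type} (c : int) (x : fsum T) : fsum T :=
  [seq (c * p.1, p.2) | p <- x].
Definition flift {A B : Type} (f : A -> fsum B) (x : fsum A) : fsum B :=
  [seq (p.1 * q.1, q.2) | p <- x, q <- f p.2].
Definition flift2 {A B C : Type} (f : A -> B -> fsum C) (x : fsum A) (y : fsum B)
  : fsum C := flift (fun a => flift (f a) y) x.
Definition ftens {A B C D : Type} (f : A -> fsum C) (g : B -> fsum D)
  (ab : A * B) : fsum (C * D) :=
  [seq (p.1 * q.1, (p.2, q.2)) | p <- f ab.1, q <- g ab.2].
Definition fid {A : Type} (a : A) : fsum A := fsingle a.
Definition fmap {A B : Type} (f : A -> B) (x : fsum A) : fsum B :=
  [seq (p.1, f p.2) | p <- x].

Definition scomp := seq {fset nat}.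

Definition ground (P : scomp) : {fset nat} := \bigcup_(B <- P) B.

Definition range (n : nat) : {fset nat} := [fset i | i in iota 1 n].

Definition is_setcomp_of (S : {fset nat}) (P : scomp) : bool :=
  all (fun B => B != fset0) P && pairwise (fun A B => fdisjoint A B) P
  && (ground P == S).

Definition Comp (n : nat) (P : scomp) : bool := is_setcomp_of (range n) P.

Definition deg (P : scomp) : nat := #|` ground P|.

(* P is a set composition of [n] for some n (i.e. a basis element of T) *)
Definition is_comp (P : scomp) : bool := Comp (deg P) P.

Definition sorted_elems (S : {fset nat}) : seq nat := sort leq (enum_fset S).

(* the unique order-preserving bijection S -> T (when |S| = |T|) *)
Definition obij (S T : {fset nat}) (x : nat) : nat :=
  nth 0 (sorted_elems T) (index x (sorted_elems S)).

Definition is_ST (S T : {fset nat}) (P : scomp) : scomp :=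
  [seq [fset obij S T x | x in B] | B <- P].
Definition is_S (S : {fset nat}) (P : scomp) : scomp := is_ST S (range #|` S|) P.

Definition restr (P : scomp) (A : {fset nat}) : scomp :=
  is_S A [seq B `&` A | B <- P & B `&` A != fset0].

Definition shift (p : nat) (B : {fset nat}) : {fset nat} := [fset (p + x)%N | x in B].

Definition ofs (n : nat) (A : {set 'I_n}) : {fset nat} :=
  [fset (nat_of_ord i).+1 | i in enum A].

Definition cmul_bar (P Q : scomp) : fsum scomp :=
  fsingle (P ++ [seq shift (deg P) B | B <- Q]).

Definition cmul_hat (P Q : scomp) : fsum scomp :=
  let p := deg P in let q := deg Q in
  [seq (1%:Z, is_ST (range p) (ofs A) P ++ is_ST (range q) (ofs (~: A)) Q)
  | A <- enum [set A : {set 'I_(p + q)} | #|A| == p]].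

Definition cop_hat (P : scomp) : fsum (scomp * scomp) :=
  let n := deg P in
  [seq (1%:Z, (restr P (ofs A), restr P (ofs (~: A)))) | A <- enum [set: {set 'I_n}]].

Definition cop_bar (P : scomp) : fsum (scomp * scomp) :=
  let n := deg P in
  [seq (1%:Z, (restr P (range p), restr P (range n `\` range p))) | p <- iota 0 n.+1].

Definition cunit : scomp := [::].
Definition ceps (P : scomp) : int := (P == [::])%:R.

(** * Graded connected (cocommutative) Hopf algebra structures on T,
      stated on basis elements (all maps being the linear extensions). *)
Definition assoc3 {A : Type} (x : A * A * A) : A * (A * A) := (x.1.1, (x.1.2, x.2)).

Definition is_graded_connected_hopf
  (mul : scomp -> scomp -> fsum scomp) (cop : scomp -> fsum (scomp * scomp)) : Prop :=
  (* Comp_0 = {()} : T_0 = Z, i.e. connectedness *)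
  (forall P, Comp 0 P = (P == [::])) /\
  (forall n m P Q, Comp n P -> Comp m Q ->
     all (fun t => Comp (n + m) t.2) (mul P Q)) /\
  (forall n P, Comp n P ->
     all (fun t => Comp (deg t.2.1) t.2.1 && Comp (deg t.2.2) t.2.2
                   && (deg t.2.1 + deg t.2.2 == n)%N) (cop P)) /\
  (forall P Q R, is_comp P -> is_comp Q -> is_comp R ->
     feq (flift2 mul (mul P Q) (fsingle R)) (flift2 mul (fsingle P) (mul Q R))) /\
  (forall P, is_comp P ->
     feq (mul cunit P) (fsingle P) /\ feq (mul P cunit) (fsingle P)) /\
  (forall P, is_comp P ->
     feq (fmap assoc3 (flift (ftens cop fid) (cop P)))
         (flift (ftens fid cop) (cop P))) /\
  (forall P, is_comp P ->
     feq [seq (t.1 * ceps t.2.1, t.2.2) | t <- cop P] (fsingle P) /\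
     feq [seq (t.1 * ceps t.2.2, t.2.1) | t <- cop P] (fsingle P)) /\
  (forall P Q, is_comp P -> is_comp Q ->
     feq (flift cop (mul P Q))
         (flift2 (fun x y => ftens (mul x.1) (mul x.2) y) (cop P) (cop Q))) /\
  feq (cop cunit) (fsingle (cunit, cunit)) /\
  (forall P Q, is_comp P -> is_comp Q ->
     \sum_(t <- mul P Q) t.1 * ceps t.2 = ceps P * ceps Q) /\
  ceps cunit = 1 /\
  (exists S : scomp -> fsum scomp,
     (forall P, is_comp P -> all (fun t => is_comp t.2) (S P)) /\
     (forall P, is_comp P ->
        feq (flift (fun ab => flift2 mul (S ab.1) (fsingle ab.2)) (cop P))
            (fscale (ceps P) (fsingle cunit)) /\
        feq (flift (fun ab => flift2 mul (fsingle ab.1) (S ab.2)) (cop P))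
            (fscale (ceps P) (fsingle cunit)))).

Definition is_cocommutative (cop : scomp -> fsum (scomp * scomp)) : Prop :=
  forall P, is_comp P -> feq (cop P) (fmap (fun ab => (ab.2, ab.1)) (cop P)).

(* A formal power series in the non-commuting variables x_1, x_2, ... is a
   function from words (seq nat; the letter i stands for x_i, i >= 1) to Z. *)
Definition series := seq nat -> int.

Definition series_mul (f g : series) : series :=
  fun w => \sum_(i < (size w).+1) f (take i w) * g (drop i w).

Definition blk (P : scomp) (j : nat) : nat := find (fun B => j \in B) P.

Definition Mser (P : scomp) : series := fun w =>
  let n := deg P in
  ((size w == n) && all (fun i => 0 < i)%N w &&
   all (fun j => all (fun j' =>
      ((nth 0 w j.-1 == nth 0 w j'.-1) == (blk P j == blk P j')) &&
      ((blk P j < blk P j')%N ==> (nth 0 w j.-1 < nth 0 w j'.-1)%N))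
      (iota 1 n)) (iota 1 n))%:R.

Definition std (P : scomp) : scomp := is_S (ground P) P.

(* coproduct of NCQsym on the basis (M_P): M_P |-> sum_i M_{is(P_1..P_i)} ⊗ M_{is(P_{i+1}..P_k)},
   recorded as a formal sum of pairs of indices *)
Definition copNCQ (P : scomp) : fsum (scomp * scomp) :=
  [seq (1%:Z, (std (take i P), std (drop i P))) | i <- iota 0 (size P).+1].

Definition tcomp (n k : nat) (t : k.-tuple {set 'I_n}) : scomp :=
  [seq ofs B | B <- t].

(* Main.v *)
Require Import Defs.
From mathcomp Require Import all_boot all_algebra.
From mathcomp Require Import finmap.
Import GRing.Theory.
Set Implicit Arguments. Unset Strict Implicit. Unset Printing Implicit Defensive.
Local Open Scope fset_scope.
Local Open Scope ring_scope.

(** A set composition of [n] is read off a word [u] of length [n]: its blocks are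
    the sets of positions of the letters of [u], in increasing order of the
    letters ([wc u]), and order-isomorphic words give the same composition.  If all
    letters of [u] are smaller than those of [v], the four structure maps become
    concatenation [u ++ v], shuffle of [u] and [v], unshuffle (complementary pairs of
    subwords) and deconcatenation, and the bialgebra axioms are inductions on words.
    Identities in the free module are tested against arbitrary functions on the basis.
    A graded connected bialgebra has a left and a right antipode, both
    constructed by recursion on the degree, and they coincide by the usual
    convolution argument. *)

(** * Linear extensions and antipodes *)

(** The obstacle is standardization: every structure map relabels ground sets by order-preserving
    bijections, and the axioms nest such relabellings. Words absorb them, since [wc] depends only on
    the relative order of the letters and a subword keeps no record of the positions it came from.
    The separation of letters encodes that in a concatenation all blocks of the first factor precede
    those of the second; it costs nothing, because adding a constant to all letters leaves [wc]
    unchanged. It passes to subwords and to shuffles, so every product inside an axiom can be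
    computed on words.

    In the duality the sums over subsets and over compositions collapse. A set composition [R] and
    the number of blocks of [P] leave one candidate for the subset in the shuffle product, and a
    word with positive letters occurs in the monomial series of exactly one composition, its own
    [wc]. *)

Definition ev {T : Type} (x : fsum T) (phi : T -> int) : int :=
  \sum_(p <- x) p.1 * phi p.2.

Lemma coef_ev (T : eqType) (x : fsum T) t : coef x t = ev x (fun s => (s == t)%:R).
Proof.
rewrite /coef /ev big_mkcond; apply: eq_bigr => p _.
by case: eqP; rewrite ?mulr1 ?mulr0.
Qed.

(** The indicator of [t] recovers the coefficient at [t]. Arbitrary functions, unlike indicators,
    are closed under the rules [ev_lift] and [ev_tens], which turn nested linear extensions into
    nested sums. *)
Lemma feq_ev (T : eqType) (x y : fsum T) :
  (forall phi, ev x phi = ev y phi) -> feq x y.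
Proof. by move=> xy t; rewrite !coef_ev. Qed.

Lemma ev_single (T : Type) (t : T) phi : ev (fsingle t) phi = phi t.
Proof. by rewrite /ev big_seq1 mul1r. Qed.

Lemma ev_scale (T : Type) c (x : fsum T) phi : ev (fscale c x) phi = c * ev x phi.
Proof. by rewrite /ev big_map mulr_sumr; apply: eq_bigr => p _; rewrite mulrA. Qed.

Lemma ev_map (A B : Type) (f : A -> B) x phi :
  ev (fmap f x) phi = ev x (fun a => phi (f a)).
Proof. by rewrite /ev big_map. Qed.

Lemma ev_reweight (A B : Type) (g : A -> int) (f : A -> B) (x : fsum A) phi :
  ev [seq (t.1 * g t.2, f t.2) | t <- x] phi = ev x (fun a => g a * phi (f a)).
Proof. by rewrite /ev big_map; apply: eq_bigr => p _; rewrite mulrA. Qed.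

Lemma ev_lift (A B : Type) (f : A -> fsum B) x phi :
  ev (flift f x) phi = ev x (fun a => ev (f a) phi).
Proof.
rewrite /ev big_allpairs_dep; apply: eq_bigr => p _.
by rewrite mulr_sumr; apply: eq_bigr => q _; rewrite mulrA.
Qed.

Lemma ev_lift2 (A B C : Type) (f : A -> B -> fsum C) x y phi :
  ev (flift2 f x y) phi = ev x (fun a => ev y (fun b => ev (f a b) phi)).
Proof. by rewrite ev_lift; apply: eq_bigr => p _; rewrite ev_lift. Qed.

Lemma ev_tens (A B C D : Type) (f : A -> fsum C) (g : B -> fsum D) ab phi :
  ev (ftens f g ab) phi = ev (f ab.1) (fun c => ev (g ab.2) (fun d => phi (c, d))).
Proof.
rewrite /ev big_allpairs_dep; apply: eq_bigr => p _.
by rewrite mulr_sumr; apply: eq_bigr => q _; rewrite mulrA.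
Qed.

Lemma eq_ev (T : Type) (x : fsum T) phi psi : phi =1 psi -> ev x phi = ev x psi.
Proof. by move=> e; apply: eq_bigr => p _; rewrite e. Qed.

Lemma eq_ev_in (T : eqType) (a : pred T) (x : fsum T) phi psi :
  all (fun p => a p.2) x -> (forall t, a t -> phi t = psi t) -> ev x phi = ev x psi.
Proof. by move=> /allP ax e; apply: eq_big_seq => p px; rewrite e ?ax. Qed.

Lemma ev_exchange (A B : Type) (x : fsum A) (y : fsum B) phi :
  ev x (fun a => ev y (phi a)) = ev y (fun b => ev x (phi^~ b)).
Proof.
rewrite /ev; under eq_bigr do rewrite mulr_sumr.
rewrite exchange_big; apply: eq_bigr => q _; rewrite mulr_sumr.
by apply: eq_bigr => p _; rewrite mulrCA.
Qed.

Lemma ev_scaler (T : Type) (x : fsum T) c phi :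
  ev x (fun t => c * phi t) = c * ev x phi.
Proof. by rewrite /ev mulr_sumr; apply: eq_bigr => p _; rewrite mulrCA. Qed.

(** Serves to isolate in a coproduct the terms with trivial right factor, which together give back
    the value of the antipode that the recursion defines. *)
Lemma ev_split (T : Type) (a : pred T) (x : fsum T) phi :
  ev x phi = ev x (fun t => (a t)%:R * phi t)
           + ev [seq p <- x | ~~ a p.2] phi.
Proof.
rewrite /ev big_filter (bigID (fun p => a p.2)) /=; congr (_ + _).
rewrite big_mkcond; apply: eq_bigr => p _.
by case: (a p.2); rewrite ?mul1r ?mul0r ?mulr0.
Qed.

Lemma all_flift (A B : Type) (f : A -> fsum B) (b : pred B) (x : fsum A) :
  all (fun p => all (fun q => b q.2) (f p.2)) x -> all (fun q => b q.2) (flift f x).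
Proof.
rewrite /flift; elim: x => //= p x IH /andP[fp /IH bx].
by rewrite all_cat all_map bx andbT.
Qed.

Lemma card_range n : #|` range n| = n.
Proof. by rewrite /range card_imfset //= undup_id ?iota_uniq // size_iota. Qed.

Lemma Comp_deg n P : Comp n P -> deg P = n.
Proof. by case/andP=> _ /eqP; rewrite /deg => ->; rewrite card_range. Qed.

Lemma Comp_is_comp n P : Comp n P -> is_comp P.
Proof. by move=> cP; rewrite /is_comp (Comp_deg cP). Qed.

Definition mul_graded (mul : scomp -> scomp -> fsum scomp) := forall n m P Q,
  Comp n P -> Comp m Q -> all (fun t => Comp (n + m) t.2) (mul P Q).
Definition cop_graded (cop : scomp -> fsum (scomp * scomp)) := forall n P, Comp n P ->
  all (fun t => Comp (deg t.2.1) t.2.1 && Comp (deg t.2.2) t.2.2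
                && (deg t.2.1 + deg t.2.2 == n)%N) (cop P).

Lemma Comp0 P : Comp 0 P = (P == [::]).
Proof.
rewrite /Comp /is_setcomp_of /ground; case: P => [|B P] /=.
  by rewrite big_nil; apply/eqP/fsetP => x; rewrite !inE.
apply/negP => /andP[/andP[/andP[/fset0Pn[x xB] _] _]] /eqP/fsetP/(_ x).
by rewrite big_cons !inE xB.
Qed.

Lemma is_comp_nil : is_comp [::].
Proof. by rewrite (@Comp_is_comp 0) // Comp0. Qed.

Lemma deg_nil : deg [::] = 0%N.
Proof. by apply: Comp_deg; rewrite Comp0. Qed.

Lemma deg_eq0 P : is_comp P -> (deg P == 0%N) = (P == [::]).
Proof.
move=> cP; apply/eqP/eqP => [d0|->]; last exact: deg_nil.
by apply/eqP; rewrite -Comp0 -d0.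
Qed.

Lemma eq_ev_comp (x : fsum scomp) phi psi : all (fun t => is_comp t.2) x ->
  (forall P, is_comp P -> phi P = psi P) -> ev x phi = ev x psi.
Proof. exact: (eq_ev_in (a := is_comp)). Qed.

Lemma eq_ev_cop cop P phi psi : cop_graded cop -> is_comp P ->
  (forall a b, is_comp a -> is_comp b -> phi (a, b) = psi (a, b)) ->
  ev (cop P) phi = ev (cop P) psi.
Proof.
move=> copG cP e; apply: (eq_ev_in (a := fun ab => is_comp ab.1 && is_comp ab.2)).
  by apply: sub_all (copG _ _ cP) => t /andP[].
by case=> a b /andP[]; apply: e.
Qed.

Section LeftAntipode.

Variables (mul : scomp -> scomp -> fsum scomp) (cop : scomp -> fsum (scomp * scomp)).
Hypotheses (mulG : mul_graded mul) (copG : cop_graded cop).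
Hypothesis mulr1 : forall P phi, is_comp P -> ev (mul P [::]) phi = phi P.
Hypothesis copr : forall P phi, is_comp P ->
  ev (cop P) (fun t => ceps t.2 * phi t.1) = phi P.

(* [n] is fuel: the terms kept have a left factor of degree [< deg P],
   so [n = deg P] suffices. *)
Fixpoint lantipode_rec (n : nat) (P : scomp) : fsum scomp :=
  if n is m.+1 then
    if P == [::] then fsingle [::] else
    fscale (-1) (flift (fun ab => flift2 mul (lantipode_rec m ab.1) (fsingle ab.2))
                       [seq t <- cop P | t.2.2 != [::]])
  else fsingle [::].
Definition lantipode P := lantipode_rec (deg P) P.

(** Connectedness makes the recursion well founded: only [[::]] has degree 0, so a non-trivial right
    factor takes at least one off the degree of the left factor. *)
Lemma left_factor_deg P c a b : is_comp P -> (c, (a, b)) \in cop P -> b != [::] ->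
  [/\ is_comp a, is_comp b & (deg a < deg P)%N].
Proof.
move=> cP abP nb; have /allP/(_ _ abP) /= /andP[/andP[ca cb] /eqP <-] := copG cP.
by rewrite -{1}(addn0 (deg a)) ltn_add2l lt0n deg_eq0 //; split.
Qed.

Lemma lantipode_rec_fuel n m P : is_comp P -> (deg P <= n)%N -> (deg P <= m)%N ->
  lantipode_rec n P = lantipode_rec m P.
Proof.
elim: n m P => [|n IH] [|m] P cP //=.
- by rewrite leqn0 deg_eq0 // => ->.
- by move=> _; rewrite leqn0 deg_eq0 // => ->.
case: eqP => // _ dn dm; congr fscale.
rewrite /flift; congr flatten; apply/eq_in_map => -[c [a b]] /=.
rewrite mem_filter /= => /andP[nb abP].
have [ca _ da] := left_factor_deg cP abP nb.
by rewrite (IH m) // -ltnS (leq_trans da).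
Qed.

Lemma ev_lantipode P phi : is_comp P -> P != [::] ->
  ev (lantipode P) phi =
  - ev [seq t <- cop P | t.2.2 != [::]]
       (fun ab => ev (lantipode ab.1) (fun x => ev (mul x ab.2) phi)).
Proof.
move=> cP nP; rewrite /lantipode; have : (0 < deg P)%N by rewrite lt0n deg_eq0.
case dP: (deg P) => [//|n] _; rewrite /= (negPf nP) ev_scale mulN1r ev_lift.
congr (- _); apply: eq_big_seq => -[c [a b]].
rewrite mem_filter /= => /andP[nb abP]; rewrite ev_lift2; congr (_ * _).
have [ca _ da] := left_factor_deg cP abP nb.
rewrite dP ltnS in da; rewrite (lantipode_rec_fuel ca da (leqnn _)).
by apply: eq_ev => x; rewrite ev_single.
Qed.

Lemma lantipode_comp P : is_comp P -> all (fun t => is_comp t.2) (lantipode P).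
Proof.
rewrite /lantipode; elim: (deg P) {1 3}P => [|n IH] {}P cP /=; first by rewrite is_comp_nil.
case: eqP => _ /=; first by rewrite is_comp_nil.
rewrite /fscale all_map /=; apply: all_flift; apply/allP => -[c [a b]] /=.
rewrite mem_filter /= => /andP[nb abP].
have [ca cb da] := left_factor_deg cP abP nb.
apply: all_flift; apply/allP => -[c' x] /= xa; apply: all_flift => /=.
rewrite andbT; have /allP/(_ _ xa) /= cx := IH _ ca.
by apply/allP => t /(allP (mulG cx cb)) /Comp_is_comp.
Qed.

(** The terms with trivial right factor add up to [lantipode P] by the right counit and unit laws,
    and the recursion defines [lantipode P] as minus the sum of all other terms. *)
Lemma lantipodeP P phi : is_comp P ->
  ev (cop P) (fun ab => ev (lantipode ab.1) (fun x => ev (mul x ab.2) phi))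
  = ceps P * phi [::].
Proof.
move=> cP; rewrite (ev_split (fun ab => ab.2 == [::])).
have -> : ev (cop P) (fun t => (t.2 == [::])%:R *
    ev (lantipode t.1) (fun x => ev (mul x t.2) phi)) = ev (lantipode P) phi.
  rewrite -(copr (fun P => ev (lantipode P) phi)) //.
  apply: eq_ev_cop => // a b ca _ /=.
  rewrite /ceps; case: eqP => [->|_]; last by rewrite !mul0r.
  congr (_ * _); apply: (eq_ev_comp (lantipode_comp ca)) => x cx.
  exact: mulr1.
rewrite /ceps; have [->|nP] := eqVneq P [::]; last first.
  by rewrite ev_lantipode // addNr mul0r.
rewrite mul1r {1}/lantipode deg_nil ev_single.
(* For [P = [::]] no other terms exist: their left factor would have degree below 0. *)
rewrite [X in _ + X](_ : _ = 0) ?addr0 // /ev big_seq big_pred0 // => -[c [a b]].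
rewrite mem_filter; apply/negbTE/negP => /= /andP[nb ab].
have [_ _] := left_factor_deg is_comp_nil ab nb.
by rewrite deg_nil.
Qed.

End LeftAntipode.

(** The hypotheses are the axioms in evaluated form. The left antipode is built from the right unit
    and counit laws; for the opposite product and the flipped coproduct these are the left laws of
    the original structure, and the same construction yields a right antipode [T]. One map has to
    serve on both sides, so [S] and [T] are shown to agree. *)
Lemma hopf_intro (mul : scomp -> scomp -> fsum scomp)
    (cop : scomp -> fsum (scomp * scomp)) :
  mul_graded mul -> cop_graded cop ->
  (forall P Q R phi, is_comp P -> is_comp Q -> is_comp R ->
     ev (mul P Q) (fun s => ev (mul s R) phi) = ev (mul Q R) (fun s => ev (mul P s) phi)) ->
  (forall P phi, is_comp P -> ev (mul [::] P) phi = phi P) ->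
  (forall P phi, is_comp P -> ev (mul P [::]) phi = phi P) ->
  (forall P phi, is_comp P ->
     ev (cop P) (fun t => ev (cop t.1) (fun s => phi s.1 s.2 t.2))
     = ev (cop P) (fun t => ev (cop t.2) (fun s => phi t.1 s.1 s.2))) ->
  (forall P phi, is_comp P -> ev (cop P) (fun t => ceps t.1 * phi t.2) = phi P) ->
  (forall P phi, is_comp P -> ev (cop P) (fun t => ceps t.2 * phi t.1) = phi P) ->
  (forall P Q phi, is_comp P -> is_comp Q ->
     ev (mul P Q) (fun s => ev (cop s) (fun t => phi t.1 t.2))
     = ev (cop P) (fun a => ev (cop Q) (fun b =>
         ev (mul a.1 b.1) (fun x => ev (mul a.2 b.2) (phi x))))) ->
  (forall phi, ev (cop [::]) phi = phi ([::], [::])) ->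
  (forall P Q, is_comp P -> is_comp Q -> ev (mul P Q) ceps = ceps P * ceps Q) ->
  is_graded_connected_hopf mul cop.
Proof.
move=> mulG copG mulA mul1 mulr1 copA copl copr mulcop cop1 epsM.
pose mul' P Q := mul Q P; pose swap (t : scomp * scomp) := (t.2, t.1).
pose cop' P := fmap swap (cop P).
have mulG' : mul_graded mul'.
  by move=> n m P Q cP cQ; rewrite addnC; apply: mulG.
have copG' : cop_graded cop'.
  move=> n P /copG; rewrite /cop' /fmap all_map; apply: sub_all => -[c [a b]] /=.
  by rewrite addnC [X in X && _]andbC.
have mulr1' P phi : is_comp P -> ev (mul' P [::]) phi = phi P by apply: mul1.
have copr' P phi : is_comp P -> ev (cop' P) (fun t => ceps t.2 * phi t.1) = phi P.
  by move=> cP; rewrite ev_map copl.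
pose S := lantipode mul cop; pose T := lantipode mul' cop'.
have SP := lantipodeP mulG copG mulr1 copr; rewrite -/S in SP.
have TP := lantipodeP mulG' copG' mulr1' copr'; rewrite -/T in TP.
have Sc : forall P, is_comp P -> all (fun t => is_comp t.2) (S P).
  exact: lantipode_comp.
have Tc : forall P, is_comp P -> all (fun t => is_comp t.2) (T P).
  exact: lantipode_comp.
have {}TP P phi : is_comp P -> ev (cop P) (fun ab =>
    ev (T ab.2) (fun y => ev (mul ab.1 y) phi)) = ceps P * phi [::].
  by move=> cP; rewrite -TP // ev_map.
have ST P phi : is_comp P -> ev (S P) phi = ev (T P) phi.
  move=> cP.
  rewrite -(copr P (fun P => ev (S P) phi)) // -(copl P (fun P => ev (T P) phi)) //.
  (* The integrand of the triple convolution of [S], the identity and [T]. Bracketed to the right it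
     collapses to [S] by [TP], bracketed to the left to [T] by [SP]; coassociativity identifies the
     two. *)
  pose phi3 a b c := ev (S a) (fun x => ev (T c) (fun z =>
    ev (mul x b) (fun s => ev (mul s z) phi))).
  transitivity (ev (cop P) (fun t => ev (cop t.2) (fun s => phi3 t.1 s.1 s.2))).
    apply: eq_ev_cop => // a b ca cb /=.
    rewrite ev_exchange -ev_scaler; apply: (eq_ev_comp (Sc a ca)) => x cx.
    rewrite -(mulr1 x phi cx) -(TP b (fun s => ev (mul x s) phi)) //.
    apply: eq_ev_cop => // c d cc cd /=.
    by apply: (eq_ev_comp (Tc d cd)) => z cz; rewrite mulA.
  rewrite -copA //; apply: eq_ev_cop => // a b ca cb /=.
  transitivity (ev (T b) (fun z => ceps a * ev (mul [::] z) phi)); last first.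
    by rewrite ev_scaler; congr (_ * _); apply: (eq_ev_comp (Tc b cb)) => z; apply: mul1.
  rewrite -(eq_ev _ (fun z => SP a (fun s => ev (mul s z) phi) ca)).
  rewrite ev_exchange; apply: eq_ev_cop => // c d cc cd /=.
  by rewrite /phi3 ev_exchange.
split; first exact: Comp0.
split; first exact: mulG.
split; first exact: copG.
split.
  move=> P Q R cP cQ cR; apply: feq_ev => phi; rewrite !ev_lift2 ev_single -mulA //.
  by apply: eq_ev => s; rewrite ev_single.
split.
  by move=> P cP; split; apply: feq_ev => phi; rewrite ev_single (mul1, mulr1).
split.
  move=> P cP; apply: feq_ev => phi; rewrite ev_map !ev_lift.
  transitivity (ev (cop P) (fun t => ev (cop t.1) (fun s => phi (s.1, (s.2, t.2))))).
    by apply: eq_ev => t; rewrite ev_tens; apply: eq_ev => s; rewrite ev_single.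
  rewrite (copA P (fun a b c => phi (a, (b, c)))) //; apply: eq_ev => t.
  by rewrite ev_tens ev_single; apply: eq_ev => -[].
split.
  move=> P cP; split; apply: feq_ev => phi; rewrite ev_single.
    by rewrite (ev_reweight (fun t => ceps t.1) (fun t => t.2)) copl.
  by rewrite (ev_reweight (fun t => ceps t.2) (fun t => t.1)) copr.
split.
  move=> P Q cP cQ; apply: feq_ev => phi; rewrite ev_lift ev_lift2.
  rewrite -[RHS](_ : ev (cop P) (fun a => ev (cop Q) (fun b => ev (mul a.1 b.1)
    (fun x => ev (mul a.2 b.2) (fun y => phi (x, y))))) = _); last first.
    by apply: eq_ev => a; apply: eq_ev => b; rewrite ev_tens.
  rewrite -(mulcop P Q (fun x y => phi (x, y))) //; apply: eq_ev => s.
  by apply: eq_ev => -[].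
split; first by apply: feq_ev => phi; rewrite cop1 ev_single.
split; first exact: epsM.
split; first by rewrite /ceps eqxx.
exists S; split => // P cP; split; apply: feq_ev => phi.
  rewrite ev_lift ev_scale ev_single -SP //; apply: eq_ev => ab.
  by rewrite ev_lift2; apply: eq_ev => x; rewrite ev_single.
rewrite ev_lift ev_scale ev_single -TP //; apply: eq_ev_cop => // a b ca cb /=.
by rewrite ev_lift2 ev_single; apply: ST.
Qed.

(** * Set compositions as level sets of functions *)

Definition level (S : {fset nat}) (f : nat -> nat) (c : nat) : {fset nat} :=
  [fset x in S | f x == c].
Definition vals (S : {fset nat}) (f : nat -> nat) : seq nat :=
  sort leq (undup [seq f x | x <- enum_fset S]).
(** A set composition amounts to a total preorder on [S], encoded here by a ranking function.
    Restriction, relabelling and shift then act on the function, and non-emptiness and disjointness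
    of blocks come for free. *)
Definition Lev (S : {fset nat}) (f : nat -> nat) : scomp :=
  [seq level S f c | c <- vals S f].

Lemma mem_level S f c x : (x \in level S f c) = (x \in S) && (f x == c).
Proof. by rewrite !inE. Qed.

Lemma sort_undup_ltn (s : seq nat) : sorted ltn (sort leq (undup s)).
Proof. by rewrite ltn_sorted_uniq_leq sort_uniq undup_uniq sort_sorted //; apply: leq_total. Qed.

Lemma vals_sorted S f : sorted ltn (vals S f).
Proof. exact: sort_undup_ltn. Qed.

Lemma mem_vals S f c : (c \in vals S f) = (c \in [seq f x | x <- enum_fset S]).
Proof. by rewrite mem_sort mem_undup. Qed.

Lemma valsP S f c : reflect (exists2 x, x \in S & c = f x) (c \in vals S f).
Proof. by rewrite mem_vals; apply: mapP. Qed.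

(** A strictly increasing list is determined by its members; this is how the list of blocks of a
    [Lev] is pinned down below. *)
Lemma vals_eq S f cs : sorted ltn cs ->
  (forall c, reflect (exists2 x, x \in S & c = f x) (c \in cs)) -> vals S f = cs.
Proof.
move=> scs csP; apply: (irr_sorted_eq ltn_trans ltnn (vals_sorted _ _) scs) => c.
by apply/valsP/csP.
Qed.

Lemma mem_ground P x : (x \in ground P) = has (fun B => x \in B) P.
Proof.
rewrite /ground; elim: P => [|B P IH] /=; first by rewrite big_nil inE.
by rewrite big_cons inE IH.
Qed.

Lemma groundP (P : scomp) x : reflect (exists2 B, B \in P & x \in B) (x \in ground P).
Proof. by rewrite mem_ground; apply: (@hasP _ (fun B : {fset nat} => x \in B)). Qed.

Lemma blk_nth P i x : pairwise (fun A B => fdisjoint A B) P -> (i < size P)%N ->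
  x \in nth fset0 P i -> blk P x = i.
Proof.
rewrite /blk; elim: P i => [|B P IH] [|i] //=; first by move=> _ _ ->.
case/andP=> /allP BP dP; rewrite ltnS => iP xi.
rewrite (IH i) //; case: ifP => // xB.
have /fdisjointP/(_ _ xB) := BP _ (mem_nth fset0 iP).
by rewrite xi.
Qed.

(** The block index takes every value below [size P] because blocks are non-empty, and its fibre at
    [i] is the [i]-th block because blocks are disjoint. *)
Lemma setcomp_Lev S P : is_setcomp_of S P -> P = Lev S (blk P).
Proof.
case/andP=> /andP[/allP nP dP] /eqP gP.
have blkP x : x \in S -> (blk P x < size P)%N /\ x \in nth fset0 P (blk P x).
  rewrite -gP mem_ground => hx; split; first by rewrite /blk -has_find.
  exact: (nth_find fset0 hx).
have inS i x : (i < size P)%N -> x \in nth fset0 P i -> x \in S.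
  move=> iP xi; rewrite -gP; apply/groundP.
  by exists (nth fset0 P i); rewrite ?mem_nth.
rewrite /Lev (@vals_eq _ _ (iota 0 (size P))) ?iota_ltn_sorted //; last first.
  move=> c; rewrite mem_iota add0n; apply: (iffP idP) => [cP|[x xS ->]].
    have /fset0Pn[x xc] := nP _ (mem_nth fset0 cP).
    by exists x; [apply: inS xc | rewrite (blk_nth dP cP xc)].
  by have [] := blkP x xS.
apply: (@eq_from_nth _ fset0); rewrite ?size_map ?size_iota // => i iP.
rewrite (nth_map 0%N) ?size_iota // nth_iota // add0n; apply/fsetP => x.
rewrite mem_level; apply/idP/andP => [xi|[xS /eqP <-]].
  by split; [apply: inS xi | rewrite (blk_nth dP iP xi)].
by have [] := blkP x xS.
Qed.

Lemma ground_Lev S f : ground (Lev S f) = S.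
Proof.
apply/fsetP => x; apply/groundP/idP => [[_ /mapP[c _ ->]]|xS].
  by rewrite mem_level => /andP[].
exists (level S f (f x)); last by rewrite mem_level xS /=.
by apply/map_f/valsP; exists x.
Qed.

Lemma Lev_setcomp S f : is_setcomp_of S (Lev S f).
Proof.
rewrite /is_setcomp_of ground_Lev eqxx andbT; apply/andP; split.
  apply/allP => _ /mapP[c /valsP[x xS ->] ->]; apply/fset0Pn; exists x.
  by rewrite mem_level xS /=.
rewrite pairwise_map; move: (vals_sorted S f); rewrite (sorted_pairwise ltn_trans).
apply: sub_pairwise => c d cd; apply/fdisjointP => x.
rewrite !mem_level => /andP[_ /eqP ->]; rewrite negb_and; apply/orP; right.
by rewrite neq_ltn cd.
Qed.

Lemma blk_Lev S f x : x \in S -> blk (Lev S f) x = index (f x) (vals S f).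
Proof.
move=> xS; rewrite /blk find_map; apply: eq_find => c /=.
by rewrite mem_level xS eq_sym.
Qed.

Lemma blk_Lev_lt S f x y : x \in S -> y \in S ->
  (blk (Lev S f) x < blk (Lev S f) y)%N = (f x < f y)%N.
Proof.
move=> xS yS; rewrite !blk_Lev //.
have mx z : z \in S -> f z \in vals S f by move=> zS; apply/valsP; exists z.
have lt := sorted_ltn_index ltn_trans (vals_sorted S f).
apply/idP/idP => [/(lt _ _ (mx x xS) (mx y yS)) // | fxy].
rewrite ltnNge leq_eqVlt negb_or; apply/andP; split; apply/negP.
  by move/eqP/(congr1 (nth 0%N (vals S f))); rewrite !nth_index ?mx // => e; rewrite e ltnn in fxy.
by move/(lt _ _ (mx y yS) (mx x xS)) => /(ltn_trans fxy); rewrite ltnn.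
Qed.

Lemma eq_Lev S f g : {in S, f =1 g} -> Lev S f = Lev S g.
Proof.
move=> fg; rewrite /Lev /vals (_ : [seq f x | x <- enum_fset S] = [seq g x | x <- enum_fset S]).
  apply: eq_map => c; apply/fsetP => x; rewrite !mem_level.
  by case xS: (x \in S) => //=; rewrite fg.
exact/eq_in_map.
Qed.

(** The hypothesis makes the passage from [f x] to [g x] well defined and increasing. The map [h]
    realizes it by evaluating [g] at the first point where [f] takes the given value; it carries
    sorted values to sorted values and preserves fibres. *)
Lemma Lev_order S f g :
  {in S &, forall x y, (f x < f y)%N = (g x < g y)%N} -> Lev S f = Lev S g.
Proof.
move=> fg.
have fgE x y : x \in S -> y \in S -> (f x == f y) = (g x == g y).
  move=> xS yS; rewrite !eqn_leq (leqNgt (f x)) (leqNgt (f y)) (leqNgt (g x)).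
  by rewrite (leqNgt (g y)) !fg.
pose h c := g (nth 0%N (enum_fset S) (find (fun x => f x == c) (enum_fset S))).
have hf x : x \in S -> h (f x) = g x.
  move=> xS; rewrite /h; set s := enum_fset S.
  have hx : has (fun y => f y == f x) s by apply/hasP; exists x.
  apply/eqP; rewrite -fgE //; first exact: (nth_find 0%N hx).
  by rewrite -[_ \in S]/(_ \in s) mem_nth // -has_find.
rewrite /Lev (@vals_eq S g (map h (vals S f))).
- rewrite -map_comp; apply/eq_in_map => _ /valsP[y yS ->] /=.
  apply/fsetP => x; rewrite !mem_level; case xS: (x \in S) => //=.
  by rewrite hf ?fgE.
- rewrite sorted_map; apply: (@sub_in_sorted _ (mem (vals S f)) ltn _ _ _ _ (vals_sorted S f)); last exact/allP.
  by move=> _ _ /valsP[x xS ->] /valsP[y yS ->] /=; rewrite !hf // fg.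
- move=> c; apply: (iffP mapP) => [[_ /valsP[x xS ->] ->]|[x xS ->]].
    by exists x => //; rewrite hf.
  by exists (f x); [apply/valsP; exists x | rewrite hf].
Qed.

Lemma Lev_restr S A f : A `<=` S ->
  [seq B `&` A | B <- Lev S f & B `&` A != fset0] = Lev A f.
Proof.
move=> /fsubsetP AS.
have lev c : level S f c `&` A = level A f c.
  apply/fsetP => x; rewrite inE !mem_level; case xA: (x \in A); rewrite ?andbF //.
  by rewrite AS //= andbT.
rewrite {2}/Lev (@vals_eq A f [seq c <- vals S f | level A f c != fset0]).
- rewrite /Lev filter_map -map_comp (eq_filter (a2 := fun c => level A f c != fset0)).
    by apply: eq_map => c /=; rewrite lev.
  by move=> c /=; rewrite lev.
- by apply: sorted_filter (vals_sorted _ _); apply: ltn_trans.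
move=> c; rewrite mem_filter; apply: (iffP andP) => [[/fset0Pn[x]]|[x xA ->]].
  by rewrite mem_level => /andP[xA /eqP <-]; exists x.
by split; [apply/fset0Pn; exists x; rewrite mem_level xA /= | apply/valsP; exists x; auto].
Qed.

(** * Transport along order-preserving bijections *)

Lemma sorted_elems_mem S x : (x \in sorted_elems S) = (x \in S).
Proof. by rewrite mem_sort. Qed.

Lemma sorted_elems_ltn S : sorted ltn (sorted_elems S).
Proof. by rewrite ltn_sorted_uniq_leq sort_uniq fset_uniq sort_sorted //; apply: leq_total. Qed.

Lemma size_sorted_elems S : size (sorted_elems S) = #|` S|.
Proof. by rewrite size_sort. Qed.

Lemma sorted_elems_eq S s : sorted ltn s -> s =i S -> sorted_elems S = s.
Proof.
move=> ss sS; apply: (irr_sorted_eq ltn_trans ltnn (sorted_elems_ltn _) ss) => x.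
by rewrite sorted_elems_mem sS.
Qed.

Lemma obij_mem S T x : #|` S| = #|` T| -> x \in S -> obij S T x \in T.
Proof.
move=> ST xS; rewrite -sorted_elems_mem mem_nth //.
by rewrite size_sorted_elems -ST -size_sorted_elems index_mem sorted_elems_mem.
Qed.

Lemma obijK S T x : #|` S| = #|` T| -> x \in S -> obij T S (obij S T x) = x.
Proof.
move=> ST xS; rewrite /obij index_uniq ?nth_index ?sorted_elems_mem //.
  by rewrite size_sorted_elems -ST -size_sorted_elems index_mem sorted_elems_mem.
by rewrite sort_uniq fset_uniq.
Qed.

Lemma is_ST_Lev S T f : #|` S| = #|` T| ->
  is_ST S T (Lev S f) = Lev T (fun x => f (obij T S x)).
Proof.
move=> ST; rewrite /is_ST /Lev -map_comp (@vals_eq T _ (vals S f)) ?vals_sorted //.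
  apply: eq_map => c /=; apply/fsetP => y; rewrite mem_level.
  apply/imfsetP/andP => [[x /=]|[yT fy]].
    rewrite mem_level => /andP[xS fx] ->.
    by rewrite obij_mem // obijK.
  by exists (obij T S y); rewrite /= ?mem_level ?obij_mem ?obijK.
move=> c; apply: (iffP (valsP _ _ _)) => [[x xS ->]|[y yT ->]].
  by exists (obij S T x); rewrite ?obij_mem ?obijK.
by exists (obij T S y); rewrite ?obij_mem.
Qed.

(** The values on [A] all precede those on [B], so the two sorted lists of values concatenate. This
    is the reason for separating the letters of two words before multiplying. *)
Lemma Lev_cat A B f : {in A & B, forall x y, (f x < f y)%N} ->
  Lev A f ++ Lev B f = Lev (A `|` B) f.
Proof.
move=> AB; rewrite {3}/Lev (@vals_eq _ _ (vals A f ++ vals B f)).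
- rewrite map_cat; congr (_ ++ _); apply/eq_in_map => _ /valsP[y yS ->];
    apply/fsetP => x; rewrite !mem_level !inE.
    case xA: (x \in A) => //=; case xB: (x \in B) => //=.
    by rewrite gtn_eqF // AB.
  case xB: (x \in B); rewrite ?orbT ?orbF //=; case xA: (x \in A) => //=.
  by rewrite ltn_eqF // AB.
- rewrite (sorted_pairwise ltn_trans) pairwise_cat -!(sorted_pairwise ltn_trans) !vals_sorted !andbT.
  by apply/allrelP => _ _ /valsP[x xA ->] /valsP[y yB ->]; apply: AB.
move=> c; rewrite mem_cat; apply: (iffP orP) => [[] /valsP[x xS ->]|[x]].
- by exists x => //; rewrite inE xS.
- by exists x => //; rewrite inE xS orbT.
by rewrite inE => /orP[] xS ->; [left | right]; apply/valsP; exists x.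
Qed.

Lemma mem_shift p S x : (x \in shift p S) = (p <= x)%N && ((x - p)%N \in S).
Proof.
apply/imfsetP/andP => [[y /= yS ->]|[px xS]]; first by rewrite leq_addr addKn.
by exists (x - p)%N => //; rewrite subnKC.
Qed.

Lemma Lev_shift p S f :
  [seq shift p B | B <- Lev S f] = Lev (shift p S) (fun x => f (x - p)%N).
Proof.
rewrite /Lev -map_comp (@vals_eq (shift p S) _ (vals S f)) ?vals_sorted //.
  by apply: eq_map => c; apply/fsetP => x; rewrite /= mem_level !mem_shift mem_level andbA.
move=> c; apply: (iffP (valsP _ _ _)) => [[x xS ->]|[y]].
  by exists (p + x)%N; rewrite ?mem_shift addKn ?leq_addr.
by rewrite mem_shift => /andP[_ yS] ->; exists (y - p)%N.
Qed.

Lemma mem_range n x : (x \in range n) = (0 < x <= n)%N.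
Proof. by rewrite /range !inE /= mem_iota add1n ltnS. Qed.

Lemma sorted_elems_range n : sorted_elems (range n) = iota 1 n.
Proof.
apply: sorted_elems_eq; first exact: iota_ltn_sorted.
by move=> x; rewrite mem_iota mem_range add1n ltnS.
Qed.

(* The set composition whose [i]-th block is the set of positions of the [i]-th
   smallest letter of [u]; every set composition of [n] arises this way. *)
Definition wc (u : seq nat) : scomp := Lev (range (size u)) (fun j => nth 0 u j.-1).

(** Positions in a composition start at 1 and list indices at 0, whence [j.-1] throughout. *)
Lemma map_nth_iota1 (u : seq nat) : [seq nth 0 u j.-1 | j <- iota 1 (size u)] = u.
Proof.
rewrite (iotaDl 1 0) -map_comp -[RHS](@mkseq_nth _ 0 u).
exact/eq_map.
Qed.

Lemma Comp_wc u : Comp (size u) (wc u).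
Proof. exact: Lev_setcomp. Qed.

Lemma deg_wc u : deg (wc u) = size u.
Proof. exact: Comp_deg (Comp_wc u). Qed.

Lemma is_comp_wc u : is_comp (wc u).
Proof. exact: Comp_is_comp (Comp_wc u). Qed.

Lemma Lev_range n f : Lev (range n) f = wc [seq f j | j <- iota 1 n].
Proof.
rewrite /wc size_map size_iota; apply: eq_Lev => x; rewrite mem_range => /andP[x0 xn].
have x1 : (x.-1 < n)%N by case: x x0 xn.
by rewrite (nth_map 0%N) ?size_iota // nth_iota // add1n prednK.
Qed.

(** Standardization reads the values of [f] along the increasing enumeration of [T]: here subsets of
    positions turn into subwords. *)
Lemma is_S_Lev T f : is_S T (Lev T f) = wc [seq f x | x <- sorted_elems T].
Proof.
rewrite /is_S is_ST_Lev ?card_range // Lev_range; congr wc.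
rewrite /obij sorted_elems_range -size_sorted_elems; set s := sorted_elems T.
apply: (@eq_from_nth _ 0%N); rewrite !size_map size_iota // => i i_s.
rewrite (nth_map 0%N) ?size_iota // (nth_map 0%N) // index_uniq ?size_iota ?iota_uniq //.
Qed.

Lemma comp_wc P : is_comp P -> exists u, P = wc u.
Proof.
move=> cP; exists [seq blk P j | j <- iota 1 (deg P)].
by rewrite -Lev_range; apply: setcomp_Lev.
Qed.

Lemma wc_map h u : {in u &, {mono h : x y / (x < y)%N}} -> wc (map h u) = wc u.
Proof.
move=> hu; rewrite /wc size_map; apply: Lev_order => x y.
rewrite !mem_range => xP yP; have pn z : (0 < z <= size u)%N -> (z.-1 < size u)%N by case: z.
by rewrite !(nth_map 0) ?pn // hu // mem_nth // pn.
Qed.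

(** * Structure maps on words *)

Lemma wc_nil : wc [::] = [::].
Proof. by apply/eqP; rewrite -Comp0 (Comp_wc [::]). Qed.

Lemma wc_eq_nil u : (wc u == [::]) = (u == [::]).
Proof. by rewrite -deg_eq0 ?is_comp_wc // deg_wc size_eq0. Qed.

(** Adding [K] to every letter keeps their order, hence the composition; this supplies
    representatives above any bound and thereby the separated words of [comp_wc2] and [comp_wc3]. *)
Lemma comp_wc_above K P : is_comp P -> exists2 u, P = wc u & all (leq K) u.
Proof.
move=> /comp_wc[u ->]; exists (map (addn K) u).
  by rewrite wc_map // => x y _ _; rewrite ltn_add2l.
by apply/allP => _ /mapP[x _ ->]; apply: leq_addr.
Qed.

Lemma words_bounded u : exists K, all (gtn K) u.
Proof.
exists (\max_(x <- u) x).+1; apply/allP => x xu /=.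
by rewrite ltnS (@leq_bigmax_seq _ u predT id).
Qed.

Lemma allrel_sep K u v : all (gtn K) u -> all (leq K) v -> allrel ltn u v.
Proof.
move=> /allP uK /allP vK; apply/allrelP => x y xu yv.
exact: leq_trans (uK x xu) (vK y yv).
Qed.

Lemma comp_wc2 P Q : is_comp P -> is_comp Q ->
  exists u v, [/\ P = wc u, Q = wc v & allrel ltn u v].
Proof.
move=> /comp_wc[u ->] cQ; have [K uK] := words_bounded u.
have [v -> vK] := comp_wc_above K cQ.
by exists u, v; split=> //; apply: allrel_sep uK vK.
Qed.

Lemma comp_wc3 P Q R : is_comp P -> is_comp Q -> is_comp R ->
  exists u v w, [/\ P = wc u, Q = wc v & R = wc w] /\
                [/\ allrel ltn u v, allrel ltn u w & allrel ltn v w].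
Proof.
move=> cP cQ /comp_wc_above cR; have [u [v [-> -> uv]]] := comp_wc2 cP cQ.
have [K] := words_bounded (u ++ v); rewrite all_cat => /andP[uK vK].
have [w -> wK] := cR K.
by exists u, v, w; do 2!split=> //; apply: allrel_sep wK.
Qed.

Lemma allrel_sub (u v u' v' : seq nat) :
  {subset u' <= u} -> {subset v' <= v} -> allrel ltn u v -> allrel ltn u' v'.
Proof.
by move=> su sv /allrelP uv; apply/allrelP => x y /su xu /sv yv; apply: uv.
Qed.

(** * Subsets of [n] as bit masks *)

Definition indmask n (A : {set 'I_n}) : bitseq := [seq i \in A | i <- enum 'I_n].

Lemma size_indmask n (A : {set 'I_n}) : size (indmask A) = n.
Proof. by rewrite size_map size_enum_ord. Qed.

Lemma count_indmask n (A : {set 'I_n}) : count id (indmask A) = #|A|.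
Proof. by rewrite count_map cardE enumT size_filter -enumT; apply: eq_count => i; rewrite inE. Qed.

Lemma indmaskC n (A : {set 'I_n}) : indmask (~: A) = map negb (indmask A).
Proof. by rewrite /indmask -map_comp; apply: eq_map => i; rewrite /= inE. Qed.

Lemma indmask_inj n : injective (@indmask n).
Proof.
move=> A B /eq_in_map AB; apply/setP => i; apply: AB.
by rewrite mem_enum.
Qed.

Lemma indmask_onto n (m : bitseq) : size m = n -> exists A : {set 'I_n}, indmask A = m.
Proof.
move=> mn; exists [set i : 'I_n | nth false m i].
rewrite -[RHS](@mkseq_nth _ false) /mkseq mn -val_enum_ord -map_comp.
by apply: eq_map => i; rewrite /= inE.
Qed.

Lemma mem_ofs n (A : {set 'I_n}) (i : 'I_n) : (i.+1 \in ofs A) = (i \in A).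
Proof.
apply/imfsetP/idP => [[j /=]|iA].
  by rewrite mem_enum => jA [/val_inj ->].
by exists i => //=; rewrite mem_enum.
Qed.

Lemma ofs_range n (A : {set 'I_n}) : ofs A `<=` range n.
Proof.
by apply/fsubsetP => _ /imfsetP[i /= _ ->]; rewrite mem_range /=.
Qed.

Lemma sorted_elems_ofs n (A : {set 'I_n}) :
  sorted_elems (ofs A) = mask (indmask A) (iota 1 n).
Proof.
apply: sorted_elems_eq.
  by apply: subseq_sorted (iota_ltn_sorted 1 n); [apply: ltn_trans | apply: mask_subseq].
have -> : iota 1 n = [seq (nat_of_ord i).+1 | i <- enum 'I_n].
  by rewrite (iotaDl 1 0) -val_enum_ord -map_comp.
rewrite -map_mask -filter_mask => x; apply/mapP/imfsetP => [] [i];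
  rewrite ?mem_filter ?mem_enum => iA ->; exists i => //=;
  by rewrite ?mem_filter ?mem_enum ?andbT in iA *.
Qed.

Lemma card_ofs n (A : {set 'I_n}) : #|` ofs A| = #|A|.
Proof.
by rewrite -size_sorted_elems sorted_elems_ofs size_mask ?count_indmask ?size_indmask ?size_iota.
Qed.

Lemma ofsU n (A : {set 'I_n}) : ofs A `|` ofs (~: A) = range n.
Proof.
apply/eqP; rewrite eqEfsubset fsubUset !ofs_range /=; apply/fsubsetP => x.
rewrite mem_range inE => /andP[x0 xn]; case: x x0 xn => // x _ xn.
by rewrite -[x]/(val (Ordinal xn)) !mem_ofs inE orbN.
Qed.

Lemma sorted_elems_letters n (A : {set 'I_n}) (u : seq nat) : size u = n ->
  [seq nth 0 u j.-1 | j <- sorted_elems (ofs A)] = mask (indmask A) u.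
Proof. by move=> un; rewrite sorted_elems_ofs map_mask -[in RHS](map_nth_iota1 u) un. Qed.

Lemma restr_wc (u : seq nat) T : T `<=` range (size u) ->
  restr (wc u) T = wc [seq nth 0 u j.-1 | j <- sorted_elems T].
Proof. by move=> Tu; rewrite /restr /wc Lev_restr // is_S_Lev. Qed.

Lemma is_ST_wc T f :
  is_ST (range #|` T|) T (wc [seq f x | x <- sorted_elems T]) = Lev T f.
Proof.
rewrite -is_S_Lev /is_S !is_ST_Lev ?card_range //; apply: eq_Lev => x xT.
by rewrite obijK ?card_range.
Qed.

Fixpoint masks n : seq bitseq :=
  if n is m.+1 then map (cons true) (masks m) ++ map (cons false) (masks m)
  else [:: [::]].

Lemma mem_masks n m : (m \in masks n) = (size m == n).
Proof.
have consI b : injective (cons b : bitseq -> bitseq) by move=> ? ? [].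
elim: n m => [|n IH] [|b m] //=.
  by rewrite mem_cat; apply/negbTE/norP; split; apply/mapP => -[].
rewrite eqSS -IH mem_cat; case: b; rewrite (mem_map (@consI _)).
  by rewrite [X in _ || X](_ : _ = false) ?orbF //; apply/mapP => -[].
by rewrite [X in X || _](_ : _ = false) //; apply/mapP => -[].
Qed.

Lemma uniq_cat_cons (s t : seq bitseq) :
  uniq (map (cons true) s ++ map (cons false) t) = uniq s && uniq t.
Proof.
rewrite cat_uniq !map_inj_uniq; try by move=> ? ? [].
rewrite [X in _ && (X && _)](_ : _ = true) //; apply/hasP => -[m /mapP[m1 _ ->]].
by case/mapP.
Qed.

Lemma uniq_masks n : uniq (masks n).
Proof. by elim: n => //= n IH; rewrite uniq_cat_cons IH. Qed.

Lemma perm_indmask n : perm_eq (map (@indmask n) (enum [set: {set 'I_n}])) (masks n).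
Proof.
apply: uniq_perm; rewrite ?uniq_masks ?map_inj_uniq ?enum_uniq //; first exact: indmask_inj.
move=> m; rewrite mem_masks; apply/mapP/eqP => [[A _ ->]|]; first exact: size_indmask.
by case/indmask_onto => A <-; exists A; rewrite ?mem_enum ?inE.
Qed.

Definition smasks p q : seq bitseq := [seq m <- masks (p + q) | count id m == p].

Lemma mem_smasks p q m : (m \in smasks p q) = (count id m == p) && (size m == p + q)%N.
Proof. by rewrite mem_filter mem_masks. Qed.

Lemma uniq_smasks p q : uniq (smasks p q).
Proof. by rewrite filter_uniq ?uniq_masks. Qed.

(** Pascal's recursion on the first bit; it becomes the first-letter recursion of the shuffle
    product. *)
Lemma smasksS p q :
  smasks p.+1 q.+1 = map (cons true) (smasks p q.+1) ++ map (cons false) (smasks p.+1 q).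
Proof.
rewrite /smasks addSn /= filter_cat !filter_map; congr (map _ _ ++ map _ _).
by rewrite -addSnnS.
Qed.

Lemma smasks0l q : smasks 0 q = [:: nseq q false].
Proof.
rewrite /smasks add0n; elim: q => //= q IH; rewrite filter_cat !filter_map.
rewrite (eq_filter (a2 := pred0)) ?filter_pred0 //=.
by rewrite (eq_filter (a2 := fun m => count id m == 0%N)) ?IH.
Qed.

Lemma smasks0r p : smasks p 0 = [:: nseq p true].
Proof.
rewrite /smasks addn0; elim: p => //= p IH; rewrite filter_cat !filter_map.
rewrite (eq_filter (a2 := fun m => count id m == p)) ?IH //=.
rewrite (_ : [seq m <- masks p | _] = [::]) //; apply/eqP.
rewrite -[_ == _]negbK -has_filter; apply/hasPn => m; rewrite mem_masks /= add0n => /eqP <-.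
by rewrite neq_ltn ltnS count_size.
Qed.

Lemma perm_indmask_card n p q : n = (p + q)%N ->
  perm_eq (map (@indmask n) (enum [set A : {set 'I_n} | #|A| == p])) (smasks p q).
Proof.
move=> npq; apply: uniq_perm; rewrite ?uniq_smasks ?map_inj_uniq ?enum_uniq //.
  exact: indmask_inj.
move=> m; rewrite mem_smasks -npq; apply/mapP/andP => [[A]|[/eqP mp /eqP]].
  by rewrite mem_enum inE => Ap ->; rewrite count_indmask size_indmask.
by case/indmask_onto => A Am; exists A; rewrite // mem_enum inE -count_indmask Am mp.
Qed.

(** Interleaves [u] and [v] as [m] prescribes, inverting the extraction of complementary subwords.
    The default letter 0 is never read when [m] lies in [smasks (size u) (size v)]. *)
Fixpoint merge_mask (m : bitseq) (u v : seq nat) : seq nat :=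
  match m with
  | [::] => [::]
  | true :: m' => head 0%N u :: merge_mask m' (behead u) v
  | false :: m' => head 0%N v :: merge_mask m' u (behead v)
  end.

Lemma size_merge_mask m u v : size (merge_mask m u v) = size m.
Proof. by elim: m u v => //= -[] m IH u v /=; rewrite IH. Qed.

Lemma merge_maskK m u v : m \in smasks (size u) (size v) ->
  mask m (merge_mask m u v) = u /\ mask (map negb m) (merge_mask m u v) = v.
Proof.
rewrite mem_smasks => /andP[/eqP mu /eqP muv].
have {muv} : count negb m = size v.
  by apply: (@addnI (size u)); rewrite -muv -mu; apply: count_predC.
elim: m u v mu => [|[] m IH] u v /=; first by case: u v => [|? ?] [|? ?].
  by case: u => //= x u; rewrite add1n add0n => -[mu] mv; have [-> ->] := IH _ _ mu mv.
by case: v => [|y v] /=; rewrite ?add1n add0n // => mu [mv]; have [-> ->] := IH _ _ mu mv.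
Qed.

(** * Shuffles, splittings and cuts of words *)

Definition shuffles u v : seq (seq nat) :=
  [seq merge_mask m u v | m <- smasks (size u) (size v)].

Lemma shuffles_cons x u y v : shuffles (x :: u) (y :: v) =
  map (cons x) (shuffles u (y :: v)) ++ map (cons y) (shuffles (x :: u) v).
Proof. by rewrite /shuffles /= smasksS map_cat -!map_comp. Qed.

Lemma shuffles_nill v : shuffles [::] v = [:: v].
Proof. by rewrite /shuffles smasks0l /=; congr [:: _]; elim: v => //= y v ->. Qed.

Lemma shuffles_nilr u : shuffles u [::] = [:: u].
Proof. by rewrite /shuffles smasks0r /=; congr [:: _]; elim: u => //= y v ->. Qed.

Lemma perm_shuffles u v s : s \in shuffles u v -> perm_eq s (u ++ v).
Proof.
elim: u v s => [|x u IHu]; first by move=> v s; rewrite shuffles_nill inE => /eqP ->.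
elim=> [|y v IHv] s; first by rewrite shuffles_nilr inE cats0 => /eqP ->.
rewrite shuffles_cons mem_cat => /orP[] /mapP[t tS ->].
  by rewrite /= perm_cons IHu.
by rewrite perm_sym -[y :: v]cat1s perm_catCA perm_cons perm_sym; apply: IHv.
Qed.

Definition splits (u : seq nat) : seq (seq nat * seq nat) :=
  [seq (mask m u, mask (map negb m) u) | m <- masks (size u)].

Lemma splits_cons x u : splits (x :: u) =
  [seq (x :: a.1, a.2) | a <- splits u] ++ [seq (a.1, x :: a.2) | a <- splits u].
Proof. by rewrite /splits /= map_cat -!map_comp. Qed.

Lemma splits_sub u a : a \in splits u -> {subset a.1 <= u} /\ {subset a.2 <= u}.
Proof. by case/mapP => m _ -> /=; split=> x /mem_mask. Qed.

Definition cuts (u : seq nat) : seq (seq nat * seq nat) :=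
  [seq (take i u, drop i u) | i <- iota 0 (size u).+1].

Lemma cuts_cons x u : cuts (x :: u) = ([::], x :: u) :: [seq (x :: a.1, a.2) | a <- cuts u].
Proof. by rewrite /cuts -map_comp /= (iotaDl 1 1) /= -map_comp. Qed.

Lemma cuts_sub u a : a \in cuts u -> {subset a.1 <= u} /\ {subset a.2 <= u}.
Proof. by case/mapP => m _ -> /=; split=> x; [apply: mem_take | apply: mem_drop]. Qed.

Lemma perm_map_in (T1 T2 : eqType) (f g : T1 -> T2) (s : seq T1) :
  {in s, f =1 g} -> perm_eq (map f s) (map g s).
Proof. by move=> /eq_in_map ->. Qed.

(** Shifting the positions of [v] by [size u] is what concatenation does, so both factors are level
    sets of one function [f], and separation of the letters makes [Lev_cat] applicable. *)
Lemma cmul_bar_wc u v : allrel ltn u v ->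
  cmul_bar (wc u) (wc v) = fsingle (wc (u ++ v)).
Proof.
move=> /allrelP uv; rewrite /cmul_bar deg_wc /wc Lev_shift; congr fsingle.
pose f j := nth 0 (u ++ v) j.-1.
rewrite (@eq_Lev (range (size u)) _ f); last first.
  move=> x; rewrite mem_range => /andP[x0 xu]; rewrite /f nth_cat.
  by case: x x0 xu => //= x _ ->.
rewrite (@eq_Lev (shift (size u) (range (size v))) _ f); last first.
  move=> x; rewrite mem_shift mem_range subn_gt0 => /and3P[_ ux _]; rewrite /f nth_cat.
  by case: x ux => //= x; rewrite ltnS => ux; rewrite ltnNge ux /= subSn.
rewrite Lev_cat; last first.
  move=> x y; rewrite mem_range mem_shift mem_range subn_gt0 leq_subLR.
  case: x y => [|x] // [|y]; rewrite ?andbF //= => xu /and3P[_]; rewrite ltnS => uy yv.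
  rewrite /f /= !nth_cat xu [(y < _)%N]ltnNge uy /=; apply: uv; rewrite mem_nth //.
  by rewrite ltn_subLR.
congr Lev; apply/fsetP => x; rewrite inE mem_shift !mem_range size_cat subn_gt0 leq_subLR.
case: x => [|x] /=; first by rewrite andbF.
case: leqP => [xu|ux] /=; first by rewrite leqW // ltnS xu.
by rewrite (leq_trans ux) ?leq_addr.
Qed.

Lemma cop_hat_wc u :
  perm_eq (cop_hat (wc u)) [seq (1, (wc a.1, wc a.2)) | a <- splits u].
Proof.
rewrite /cop_hat deg_wc /splits -map_comp.
apply: (@perm_trans _ [seq (1, (wc (mask m u), wc (mask (map negb m) u))) |
    m <- map (@indmask _) (enum [set: {set 'I_(size u)}])]).
  rewrite -map_comp; apply: perm_map_in => A _ /=.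
  by rewrite !restr_wc ?ofs_range // !sorted_elems_letters // indmaskC.
by apply: perm_map; apply: perm_indmask.
Qed.

(** Each subset [A] gives a merged word [s] having [u] and [v] as its subwords at [A] and at the
    complement. By [is_ST_wc] the two relabelled factors are the level sets of [s] on these sets,
    and [Lev_cat] glues them to [wc s]. *)
Lemma cmul_hat_wc u v : allrel ltn u v ->
  perm_eq (cmul_hat (wc u) (wc v)) [seq (1, wc s) | s <- shuffles u v].
Proof.
move=> /allrelP uv; rewrite /cmul_hat !deg_wc /shuffles -map_comp.
apply: (@perm_trans _ [seq (1, wc (merge_mask m u v)) | m <-
    map (@indmask _) (enum [set A : {set 'I_(size u + size v)} | #|A| == size u])]).
  rewrite -map_comp; apply: perm_map_in => A.
  rewrite mem_enum inE => /eqP Au /=; congr (_, _).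
  have mA : indmask A \in smasks (size u) (size v).
    by rewrite mem_smasks count_indmask size_indmask Au !eqxx.
  have [eu ev] := merge_maskK mA; set s := merge_mask _ u v in eu ev *.
  have ss : size s = (size u + size v)%N by rewrite size_merge_mask size_indmask.
  have Av : #|~: A| = size v by rewrite cardsCs setCK card_ord Au addKn.
  rewrite -[in range (size u)]Au -[in range (size v)]Av -!card_ofs -[in wc u]eu -[in wc v]ev.
  rewrite -indmaskC -!(sorted_elems_letters _ ss) !is_ST_wc Lev_cat ?ofsU -?ss //.
  move=> x y xA yA; apply: uv.
    rewrite -eu -(sorted_elems_letters _ ss).
    by apply: (map_f (fun j => nth 0 s j.-1)); rewrite sorted_elems_mem.
  rewrite -ev -indmaskC -(sorted_elems_letters _ ss).
  by apply: (map_f (fun j => nth 0 s j.-1)); rewrite sorted_elems_mem.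
by apply: perm_map; apply: perm_indmask_card.
Qed.

Lemma cop_bar_wc u : cop_bar (wc u) = [seq (1, (wc a.1, wc a.2)) | a <- cuts u].
Proof.
rewrite /cop_bar deg_wc /cuts -map_comp; apply/eq_in_map => p.
rewrite mem_iota add0n ltnS => /andP[_ pu] /=; congr (_, (_, _)).
  rewrite restr_wc; last first.
    apply/fsubsetP => x; rewrite !mem_range => /andP[-> xp] /=.
    exact: leq_trans xp pu.
  by rewrite sorted_elems_range -[in RHS](map_nth_iota1 u) -map_take take_iota (minn_idPl pu).
rewrite restr_wc; last exact: fsubsetDl.
rewrite (@sorted_elems_eq _ (iota p.+1 (size u - p))) ?iota_ltn_sorted //.
  by rewrite -[in RHS](map_nth_iota1 u) -map_drop drop_iota add1n.
move=> x; rewrite mem_iota inE !mem_range negb_and -!ltnNge addSn subnKC // ltnS.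
by case: x => //= x; rewrite andbC.
Qed.

(** * Shuffle and unshuffle identities *)

Lemma ev_perm (T : eqType) (x y : fsum T) phi : perm_eq x y -> ev x phi = ev y phi.
Proof. by move=> xy; apply: perm_big. Qed.

Lemma ev_basis (I T : Type) (f : I -> T) l phi :
  ev [seq (1, f s) | s <- l] phi = \sum_(s <- l) phi (f s).
Proof. by rewrite /ev big_map; apply: eq_bigr => s _; rewrite mul1r. Qed.

Lemma ev_cop_hat u phi :
  ev (cop_hat (wc u)) phi = \sum_(a <- splits u) phi (wc a.1, wc a.2).
Proof. by rewrite (ev_perm _ (cop_hat_wc u)) ev_basis. Qed.

Lemma ev_cop_bar u phi :
  ev (cop_bar (wc u)) phi = \sum_(a <- cuts u) phi (wc a.1, wc a.2).
Proof. by rewrite cop_bar_wc ev_basis. Qed.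

Lemma ev_cmul_bar u v phi : allrel ltn u v ->
  ev (cmul_bar (wc u) (wc v)) phi = phi (wc (u ++ v)).
Proof. by move=> uv; rewrite cmul_bar_wc // ev_single. Qed.

Lemma ev_cmul_hat u v phi : allrel ltn u v ->
  ev (cmul_hat (wc u) (wc v)) phi = \sum_(s <- shuffles u v) phi (wc s).
Proof. by move=> uv; rewrite (ev_perm _ (cmul_hat_wc uv)) ev_basis. Qed.

Section WordSums.

Variable V : nmodType.

Lemma sum_splits_cons x u (F : _ -> V) : \sum_(a <- splits (x :: u)) F a =
  \sum_(a <- splits u) F (x :: a.1, a.2) + \sum_(a <- splits u) F (a.1, x :: a.2).
Proof. by rewrite splits_cons big_cat !big_map. Qed.

Lemma sum_splits_nil (F : _ -> V) : \sum_(a <- splits [::]) F a = F ([::], [::]).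
Proof. by rewrite big_seq1. Qed.

Lemma sum_cuts_cons x u (F : _ -> V) : \sum_(a <- cuts (x :: u)) F a =
  F ([::], x :: u) + \sum_(a <- cuts u) F (x :: a.1, a.2).
Proof. by rewrite cuts_cons big_cons big_map. Qed.

Lemma sum_cuts_nil (F : _ -> V) : \sum_(a <- cuts [::]) F a = F ([::], [::]).
Proof. by rewrite big_seq1. Qed.

Lemma sum_shuffles_cons x u y v (F : _ -> V) : \sum_(s <- shuffles (x :: u) (y :: v)) F s =
  \sum_(s <- shuffles u (y :: v)) F (x :: s) + \sum_(s <- shuffles (x :: u) v) F (y :: s).
Proof. by rewrite shuffles_cons big_cat !big_map. Qed.

Lemma sum_shuffles_nill v (F : _ -> V) : \sum_(s <- shuffles [::] v) F s = F v.
Proof. by rewrite shuffles_nill big_seq1. Qed.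

Lemma sum_shuffles_nilr u (F : _ -> V) : \sum_(s <- shuffles u [::]) F s = F u.
Proof. by rewrite shuffles_nilr big_seq1. Qed.

(** Both sides run over all ways to distribute the letters of [u] over three subwords; the induction
    decides where the first letter goes. *)
Lemma splitsA u (F : seq nat -> seq nat -> seq nat -> V) :
  \sum_(a <- splits u) \sum_(b <- splits a.1) F b.1 b.2 a.2
  = \sum_(a <- splits u) \sum_(b <- splits a.2) F a.1 b.1 b.2.
Proof.
elim: u F => [|x u IH] F; first by rewrite !sum_splits_nil.
rewrite !sum_splits_cons /=.
under eq_bigr do rewrite sum_splits_cons.
under [X in _ = _ + X]eq_bigr do rewrite sum_splits_cons.
rewrite !big_split /= (IH (fun a b c => F (x :: a) b c)).
by rewrite (IH (fun a b c => F a (x :: b) c)) (IH (fun a b c => F a b (x :: c))) addrA.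
Qed.

Lemma splits_cat u v (F : _ -> V) : \sum_(a <- splits (u ++ v)) F a =
  \sum_(a <- splits u) \sum_(b <- splits v) F (a.1 ++ b.1, a.2 ++ b.2).
Proof.
elim: u F => [|x u IH] F /=.
  by rewrite sum_splits_nil; apply: eq_bigr => -[].
by rewrite !sum_splits_cons !IH.
Qed.

Lemma splitsC u (F : _ -> V) :
  \sum_(a <- splits u) F a = \sum_(a <- splits u) F (a.2, a.1).
Proof.
elim: u F => [|x u IH] F; first by rewrite !sum_splits_nil.
by rewrite !sum_splits_cons addrC (IH (fun a => F (x :: a.1, a.2))) /=
  (IH (fun a => F (a.1, x :: a.2))).
Qed.

Lemma cutsA u (F : seq nat -> seq nat -> seq nat -> V) :
  \sum_(a <- cuts u) \sum_(b <- cuts a.1) F b.1 b.2 a.2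
  = \sum_(a <- cuts u) \sum_(b <- cuts a.2) F a.1 b.1 b.2.
Proof.
elim: u F => [|x u IH] F; first by rewrite !sum_cuts_nil.
rewrite !sum_cuts_cons !sum_cuts_nil /=.
under eq_bigr do rewrite sum_cuts_cons.
by rewrite big_split /= (IH (fun a b c => F (x :: a) b c)) addrA.
Qed.

(** The first letter of a triple shuffle comes from [u], [v] or [w], and each of the three cases
    falls under one of the nested induction hypotheses. *)
Lemma shufflesA u v w (F : _ -> V) :
  \sum_(s <- shuffles u v) \sum_(t <- shuffles s w) F t
  = \sum_(s <- shuffles v w) \sum_(t <- shuffles u s) F t.
Proof.
elim: u v w F => [|x u IHu] v w F.
  by rewrite sum_shuffles_nill; apply: eq_bigr => s _; rewrite sum_shuffles_nill.
elim: v w F => [|y v IHv] w F; first by rewrite sum_shuffles_nilr sum_shuffles_nill.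
elim: w F => [|z w IHw] F.
  by rewrite sum_shuffles_nilr; apply: eq_bigr => s _; rewrite sum_shuffles_nilr.
rewrite !sum_shuffles_cons.
under eq_bigr do rewrite sum_shuffles_cons.
under [X in _ + X = _]eq_bigr do rewrite sum_shuffles_cons.
under [X in _ = X + _]eq_bigr do rewrite sum_shuffles_cons.
under [X in _ = _ + X]eq_bigr do rewrite sum_shuffles_cons.
rewrite !big_split /= addrACA [RHS]addrACA.
(* Each side has split into four sums. The two that start with [z] on the left, and the two that
   start with [x] on the right, are merged again so that the induction hypotheses match. *)
rewrite -(sum_shuffles_cons x u y v (fun s => \sum_(t <- shuffles s w) F (z :: t))).
rewrite -(sum_shuffles_cons y v z w (fun s => \sum_(t <- shuffles u s) F (x :: t))).
rewrite (IHw (fun s => F (z :: s))) (IHu _ _ (fun s => F (x :: s))).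
by rewrite (IHv _ (fun s => F (y :: s))) addrA.
Qed.

(** Cutting a shuffle of [u] and [v] cuts both words, and the two parts are a shuffle of the initial
    pieces and a shuffle of the final pieces. *)
Lemma shuffles_cuts u v (F : _ -> V) :
  \sum_(s <- shuffles u v) \sum_(a <- cuts s) F a
  = \sum_(a <- cuts u) \sum_(b <- cuts v)
      \sum_(s <- shuffles a.1 b.1) \sum_(t <- shuffles a.2 b.2) F (s, t).
Proof.
elim: u v F => [|x u IHu] v F.
  rewrite sum_shuffles_nill sum_cuts_nil; apply: eq_bigr => b _.
  by rewrite !sum_shuffles_nill -surjective_pairing.
elim: v F => [|y v IHv] F.
  rewrite sum_shuffles_nilr; apply: eq_bigr => a _.
  by rewrite sum_cuts_nil !sum_shuffles_nilr -surjective_pairing.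
have hd s : forall x', \sum_(a <- cuts (x' :: s)) F a
    = F ([::], x' :: s) + \sum_(a <- cuts s) F (x' :: a.1, a.2).
  by move=> x'; rewrite sum_cuts_cons.
rewrite sum_shuffles_cons; under eq_bigr do rewrite hd.
under [X in _ + X = _]eq_bigr do rewrite hd.
rewrite !big_split /= addrACA.
rewrite -(sum_shuffles_cons x u y v (fun s => F ([::], s))).
rewrite (IHu _ (fun a => F (x :: a.1, a.2))) (IHv (fun a => F (y :: a.1, a.2))).
(* The cut before the first letter corresponds to two empty initial pieces. The other pairs are
   sorted by which initial piece is empty, and when neither is, by the word supplying the first
   letter. *)
rewrite !sum_cuts_cons /= sum_shuffles_nill -addrA; congr (_ + _).
under eq_bigr do rewrite sum_cuts_cons /= sum_shuffles_nilr.
under [X in _ = _ + X]eq_bigr do rewrite sum_cuts_cons /= sum_shuffles_nilr.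
rewrite !big_split /= addrCA; congr (_ + _).
  by apply: eq_bigr => b _; rewrite !sum_shuffles_nill.
rewrite -addrA; congr (_ + _); rewrite -big_split; apply: eq_bigr => a _.
by rewrite -big_split; apply: eq_bigr => b _ /=; rewrite sum_shuffles_cons.
Qed.

End WordSums.

Lemma splits_counit u (F : seq nat -> int) :
  \sum_(a <- splits u) (a.1 == [::])%:R * F a.2 = F u.
Proof.
elim: u F => [|x u IH] F; first by rewrite sum_splits_nil mul1r.
rewrite sum_splits_cons /= big1 ?add0r => [|a _]; last by rewrite mul0r.
exact: (IH (fun s => F (x :: s))).
Qed.

Lemma cuts_counitl u (F : seq nat -> int) :
  \sum_(a <- cuts u) (a.1 == [::])%:R * F a.2 = F u.
Proof.
case: u => [|x u]; first by rewrite sum_cuts_nil mul1r.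
rewrite sum_cuts_cons /= big1 ?addr0 ?mul1r // => a _.
by rewrite mul0r.
Qed.

Lemma cuts_counitr u (F : seq nat -> int) :
  \sum_(a <- cuts u) (a.2 == [::])%:R * F a.1 = F u.
Proof.
elim: u F => [|x u IH] F; first by rewrite sum_cuts_nil mul1r.
by rewrite sum_cuts_cons /= mul0r add0r (IH (fun s => F (x :: s))).
Qed.

(** * The two Hopf algebra structures *)

Lemma Comp_wcE n u : Comp n (wc u) -> n = size u.
Proof. by move/Comp_deg; rewrite deg_wc. Qed.

Lemma cmul_bar_graded : mul_graded cmul_bar.
Proof.
move=> n m P Q cP cQ.
have [u [v [eP eQ uv]]] := comp_wc2 (Comp_is_comp cP) (Comp_is_comp cQ).
move: cP cQ; rewrite {}eP {}eQ => /Comp_wcE -> /Comp_wcE ->.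
by rewrite cmul_bar_wc //= -size_cat Comp_wc.
Qed.

Lemma cmul_hat_graded : mul_graded cmul_hat.
Proof.
move=> n m P Q cP cQ.
have [u [v [eP eQ uv]]] := comp_wc2 (Comp_is_comp cP) (Comp_is_comp cQ).
move: cP cQ; rewrite {}eP {}eQ => /Comp_wcE -> /Comp_wcE ->.
rewrite (perm_all _ (cmul_hat_wc uv)) all_map; apply/allP => s /perm_shuffles/perm_size.
by rewrite size_cat /= => <-; apply: Comp_wc.
Qed.

Lemma cop_hat_graded : cop_graded cop_hat.
Proof.
move=> n P cP; have [u eP] := comp_wc (Comp_is_comp cP).
move: cP; rewrite {}eP => /Comp_wcE ->.
rewrite (perm_all _ (cop_hat_wc u)) all_map; apply/allP => _ /mapP[m + ->] /=.
rewrite mem_masks !deg_wc !Comp_wc /= => /eqP mu.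
by rewrite !size_mask ?size_map // count_map -mu (count_predC id m).
Qed.

Lemma cop_bar_graded : cop_graded cop_bar.
Proof.
move=> n P cP; have [u eP] := comp_wc (Comp_is_comp cP).
move: cP; rewrite {}eP => /Comp_wcE ->.
rewrite cop_bar_wc all_map; apply/allP => _ /mapP[i _ ->] /=.
by rewrite !deg_wc !Comp_wc /= -size_cat cat_take_drop.
Qed.

Lemma ceps_wc u : ceps (wc u) = (u == [::])%:R.
Proof. by rewrite /ceps wc_eq_nil. Qed.

Lemma cop_hat_cocommutative : is_cocommutative cop_hat.
Proof.
move=> P /comp_wc[u ->]; apply: feq_ev => phi.
by rewrite ev_map !ev_cop_hat (splitsC u (fun a => phi (wc a.1, wc a.2))).
Qed.

Lemma hopf_bar_hat : is_graded_connected_hopf cmul_bar cop_hat.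
Proof.
apply: hopf_intro.
- exact: cmul_bar_graded.
- exact: cop_hat_graded.
- move=> P Q R phi cP cQ cR.
  have [u [v [w [[-> -> ->] [uv uw vw]]]]] := comp_wc3 cP cQ cR.
  by rewrite !ev_cmul_bar ?allrel_catl ?allrel_catr ?uv ?uw ?vw // catA.
- move=> P phi /comp_wc[u ->].
  by rewrite -wc_nil ev_cmul_bar ?allrel0l.
- move=> P phi /comp_wc[u ->].
  by rewrite -wc_nil ev_cmul_bar ?allrel0r // cats0.
- move=> P phi /comp_wc[u ->]; rewrite !ev_cop_hat.
  under eq_bigr do rewrite ev_cop_hat.
  under [RHS]eq_bigr do rewrite ev_cop_hat.
  exact: (splitsA u (fun a b c => phi (wc a) (wc b) (wc c))).
- move=> P phi /comp_wc[u ->]; rewrite ev_cop_hat.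
  under eq_bigr do rewrite ceps_wc.
  exact: (splits_counit u (fun s => phi (wc s))).
- move=> P phi /comp_wc[u ->]; rewrite ev_cop_hat.
  under eq_bigr do rewrite ceps_wc.
  rewrite (splitsC u (fun a => (a.2 == [::])%:R * phi (wc a.1))).
  exact: (splits_counit u (fun s => phi (wc s))).
- move=> P Q phi cP cQ; have [u [v [-> -> uv]]] := comp_wc2 cP cQ.
  rewrite ev_cmul_bar // !ev_cop_hat splits_cat; apply: eq_big_seq => a au.
  rewrite ev_cop_hat; apply: eq_big_seq => b bv.
  have [[a1 a2] [b1 b2]] := (splits_sub au, splits_sub bv).
  by rewrite !ev_cmul_bar //; [apply: allrel_sub uv .. ].
- by move=> phi; rewrite -wc_nil ev_cop_hat sum_splits_nil.
move=> P Q cP cQ; have [u [v [-> -> uv]]] := comp_wc2 cP cQ.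
by rewrite ev_cmul_bar // !ceps_wc -natrM mulnb; case: u {uv}.
Qed.

Lemma hopf_hat_bar : is_graded_connected_hopf cmul_hat cop_bar.
Proof.
apply: hopf_intro.
- exact: cmul_hat_graded.
- exact: cop_bar_graded.
- move=> P Q R phi cP cQ cR.
  have [u [v [w [[-> -> ->] [uv uw vw]]]]] := comp_wc3 cP cQ cR.
  rewrite !ev_cmul_hat //.
  rewrite (eq_big_seq (fun s => \sum_(t <- shuffles s w) phi (wc t))); last first.
    move=> s /perm_shuffles/perm_mem su; rewrite ev_cmul_hat //.
    apply: (@allrel_sub (u ++ v) w) => // [x|]; first by rewrite su.
    by rewrite allrel_catl uw vw.
  rewrite [RHS](eq_big_seq (fun s => \sum_(t <- shuffles u s) phi (wc t))); last first.
    move=> s /perm_shuffles/perm_mem sv; rewrite ev_cmul_hat //.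
    apply: (@allrel_sub u (v ++ w)) => // [x|]; first by rewrite sv.
    by rewrite allrel_catr uv uw.
  exact: shufflesA.
- move=> P phi /comp_wc[u ->].
  by rewrite -wc_nil ev_cmul_hat ?allrel0l // sum_shuffles_nill.
- move=> P phi /comp_wc[u ->].
  by rewrite -wc_nil ev_cmul_hat ?allrel0r // sum_shuffles_nilr.
- move=> P phi /comp_wc[u ->]; rewrite !ev_cop_bar.
  under eq_bigr do rewrite ev_cop_bar.
  under [RHS]eq_bigr do rewrite ev_cop_bar.
  exact: (cutsA u (fun a b c => phi (wc a) (wc b) (wc c))).
- move=> P phi /comp_wc[u ->]; rewrite ev_cop_bar.
  under eq_bigr do rewrite ceps_wc.
  exact: (cuts_counitl u (fun s => phi (wc s))).
- move=> P phi /comp_wc[u ->]; rewrite ev_cop_bar.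
  under eq_bigr do rewrite ceps_wc.
  exact: (cuts_counitr u (fun s => phi (wc s))).
- move=> P Q phi cP cQ; have [u [v [-> -> uv]]] := comp_wc2 cP cQ.
  rewrite ev_cmul_hat // ev_cop_bar; under eq_bigr do rewrite ev_cop_bar.
  rewrite (shuffles_cuts u v (fun a => phi (wc a.1) (wc a.2))).
  apply: eq_big_seq => a au; rewrite ev_cop_bar; apply: eq_big_seq => b bv.
  have [[a1 a2] [b1 b2]] := (cuts_sub au, cuts_sub bv).
  rewrite ev_cmul_hat; last exact: allrel_sub uv.
  by apply: eq_bigr => s _; rewrite ev_cmul_hat //; apply: allrel_sub uv.
- by move=> phi; rewrite -wc_nil ev_cop_bar sum_cuts_nil.
move=> P Q cP cQ; have [u [v [-> -> uv]]] := comp_wc2 cP cQ.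
rewrite ev_cmul_hat // !ceps_wc.
(* A shuffle has the length of [u ++ v] and is empty exactly when both words are, so the indicators
   of [u] and [v] may be inserted in every term. *)
rewrite (eq_big_seq (fun s => ((u == [::])%:R * (v == [::])%:R) * (s == [::])%:R)).
  case: u {uv} => [|x u]; first by rewrite sum_shuffles_nill; case: v.
  by rewrite mul0r big1 // => s _; rewrite !mul0r.
move=> s /perm_shuffles/perm_size; rewrite ceps_wc size_cat.
by case: s => [|x s]; case: u {uv}; case: v => //; rewrite ?mulr0.
Qed.

(** * Duality with NCQsym *)

Lemma is_STK S T P : #|` S| = #|` T| -> is_setcomp_of S P ->
  is_ST T S (is_ST S T P) = P.
Proof.
move=> ST /setcomp_Lev ->; rewrite !is_ST_Lev //; apply: eq_Lev => x xS.
by rewrite obijK.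
Qed.

Lemma is_ST_setcomp S T P : #|` S| = #|` T| -> is_setcomp_of S P ->
  is_setcomp_of T (is_ST S T P).
Proof. by move=> ST /setcomp_Lev ->; rewrite is_ST_Lev //; apply: Lev_setcomp. Qed.

Lemma setcomp_ground S P : is_setcomp_of S P -> ground P = S.
Proof. by case/andP=> _ /eqP. Qed.

Lemma std_comp P : is_setcomp_of (ground P) P -> Comp (deg P) (std P).
Proof. by move=> cP; apply: is_ST_setcomp; rewrite ?card_range. Qed.

Lemma is_ST_std P S : #|` S| = #|` range (deg P)| -> is_setcomp_of (ground P) P ->
  ground P = S -> is_ST (range (deg P)) S (std P) = P.
Proof. by move=> cS cP <-; apply: is_STK => //; rewrite card_range. Qed.

Lemma std_is_ST n S P : #|` S| = n -> is_setcomp_of (range n) P ->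
  std (is_ST (range n) S P) = P.
Proof.
move=> Sn cP; have cS : #|` range n| = #|` S| by rewrite card_range.
rewrite /std (setcomp_ground (is_ST_setcomp cS cP)) /is_S Sn.
exact: is_STK.
Qed.

Lemma setcomp_subseq S P Q : subseq Q P -> is_setcomp_of S P ->
  is_setcomp_of (ground Q) Q.
Proof.
move=> QP /andP[/andP[/allP nP dP] _]; rewrite /is_setcomp_of eqxx andbT.
rewrite (subseq_pairwise QP dP) andbT; apply/allP => B BQ.
by apply: nP; apply: mem_subseq QP _ BQ.
Qed.

Lemma ground_cat P Q : ground (P ++ Q) = ground P `|` ground Q.
Proof. by apply/fsetP => x; rewrite inE !mem_ground has_cat. Qed.

Lemma ground_cat_disjoint S P Q : is_setcomp_of S (P ++ Q) ->
  [disjoint ground P & ground Q].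
Proof.
case/andP=> /andP[_]; rewrite pairwise_cat => /and3P[/allrelP PQ _ _] _.
apply/fdisjointP => x /groundP[B BP xB]; apply/negP => /groundP[C CQ xC].
by have /fdisjointP/(_ _ xB) := PQ _ _ BP CQ; rewrite xC.
Qed.

Definition pre_ofs n (S : {fset nat}) : {set 'I_n} := [set i : 'I_n | i.+1 \in S].

Lemma ofs_preK n S : S `<=` range n -> ofs (pre_ofs n S) = S.
Proof.
move=> /fsubsetP Sn; apply/fsetP => x; apply/idP/idP => [xA|xS].
  have := fsubsetP (ofs_range (pre_ofs n S)) _ xA; rewrite mem_range.
  case: x xA => // x + xn; rewrite -[x]/(val (Ordinal xn)) mem_ofs.
  by rewrite inE.
have := Sn _ xS; rewrite mem_range; case: x xS => // x xS xn.
by rewrite -[x]/(val (Ordinal xn)) mem_ofs inE.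
Qed.

Lemma ofsC n (A : {set 'I_n}) : ofs (~: A) = range n `\` ofs A.
Proof.
apply/fsetP => x; rewrite in_fsetD; case xn: (x \in range n); last first.
  by rewrite andbF; apply/(contraFF _ xn)/fsubsetP/ofs_range.
move: xn; rewrite mem_range andbT; case: x => // x xn.
by rewrite -[x]/(val (Ordinal xn)) !mem_ofs inE.
Qed.

Lemma ofsK n (A : {set 'I_n}) : pre_ofs n (ofs A) = A.
Proof. by apply/setP => i; rewrite inE mem_ofs. Qed.

Lemma ofs_inj n : injective (@ofs n).
Proof. exact: can_inj (@ofsK n). Qed.

(** Standardization keeps the number of blocks, so only the cut after [size P] blocks can produce
    [P] on the left. *)
Lemma coef_copNCQ (P Q R : scomp) : coef (copNCQ R) (P, Q) =
  [&& size P <= size R, std (take (size P) R) == P & std (drop (size P) R) == Q]%N%:R.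
Proof.
rewrite coef_ev /copNCQ ev_basis.
have out i : i \in iota 0 (size R).+1 -> i != size P ->
    ((std (take i R), std (drop i R)) == (P, Q))%:R = 0 :> int.
  rewrite mem_iota add0n ltnS => /andP[_ iR] /eqP iP; case: eqP => // -[eP _].
  by case: iP; rewrite -eP /std /is_S /is_ST size_map size_takel.
have [PR|PR] := leqP (size P) (size R).
  rewrite (bigD1_seq (size P)) ?iota_uniq ?mem_iota ?ltnS //.
  rewrite big_seq_cond big1 => [|i /andP[]]; last exact: out.
  exact: addr0.
rewrite big_seq big1 // => i iR; apply: out => //.
by move: iR; rewrite mem_iota add0n ltnS => /andP[_ iR]; rewrite ltn_eqF // (leq_ltn_trans iR).
Qed.

(** A term equal to [R] has the relabelled [P] as its first [size P] blocks, which forces [A] to be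
    their ground set. Both coefficients are therefore 0 or 1, under the same condition [C]. *)
Lemma coef_cmul_hat P Q R : is_comp P -> is_comp Q -> is_comp R ->
  coef (cmul_hat P Q) R = coef (copNCQ R) (P, Q).
Proof.
move=> cP cQ cR; rewrite coef_copNCQ coef_ev /cmul_hat ev_basis.
set p := deg P; set q := deg Q; set C := [&& _, _ & _].
pose k := size P.
have split_cat (A : {set 'I_(p + q)}) : #|A| = p ->
    is_ST (range p) (ofs A) P ++ is_ST (range q) (ofs (~: A)) Q = R ->
    C /\ ofs A = ground (take k R).
  move=> Ap eR; have Aq : #|~: A| = q.
    by rewrite cardsCs setCK card_ord Ap addKn.
  have sk : size (is_ST (range p) (ofs A) P) = k by rewrite size_map.
  have tk : take k R = is_ST (range p) (ofs A) P by rewrite -eR -sk take_size_cat.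
  have dk : drop k R = is_ST (range q) (ofs (~: A)) Q by rewrite -eR -sk drop_size_cat.
  rewrite tk; split.
    rewrite /C -/k tk dk !std_is_ST ?card_ofs ?eqxx ?andbT //.
    by rewrite -eR size_cat sk leq_addr.
  symmetry; apply: setcomp_ground; apply: is_ST_setcomp cP.
  by rewrite card_range card_ofs.
rewrite big_enum /=.
have [C1|C0] := boolP C; last first.
  rewrite big1 // => A; rewrite inE => /eqP Ap; case: eqP => // eR.
  by have [] := split_cat A Ap eR; rewrite (negPf C0).
have /and3P[kR /eqP tP /eqP dQ] := C1.
have ct : is_setcomp_of (ground (take k R)) (take k R).
  exact: setcomp_subseq (take_subseq _ _) cR.
have cd : is_setcomp_of (ground (drop k R)) (drop k R).
  exact: setcomp_subseq (drop_subseq _ _) cR.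
have dt : deg (take k R) = p by rewrite /p -tP (Comp_deg (std_comp ct)).
have dd : deg (drop k R) = q by rewrite /q -dQ (Comp_deg (std_comp cd)).
have gR : ground (take k R) `|` ground (drop k R) = range (deg R).
  by rewrite -ground_cat cat_take_drop (setcomp_ground cR).
have disj : [disjoint ground (take k R) & ground (drop k R)].
  by apply: (@ground_cat_disjoint (range (deg R))); rewrite cat_take_drop.
have dR : deg R = (p + q)%N.
  by rewrite -dt -dd -[LHS]card_range -gR cardfsU (eqP disj) cardfs0 subn0.
rewrite dR in gR.
have gt : ground (take k R) `<=` range (p + q) by rewrite -gR fsubsetUl.
(* The forced subset. It contributes because relabelling inverts the standardization of the two
   parts of [R]. *)
pose A0 := pre_ofs (p + q) (ground (take k R)).
have oA0 : ofs A0 = ground (take k R) by apply: ofs_preK.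
have oA0C : ofs (~: A0) = ground (drop k R).
  rewrite ofsC oA0; apply/fsetP => x; rewrite -gR !inE.
  by case xt: (x \in ground (take k R)) => //=; rewrite (negPf (fdisjointP disj _ xt)).
have A0p : #|A0| = p by rewrite -card_ofs oA0.
rewrite (bigD1 A0) /= ?inE ?A0p //= big1 ?addr0.
  rewrite oA0 oA0C -{1}dt -{1}dd -{1}tP -{1}dQ !is_ST_std ?card_range //.
  by rewrite cat_take_drop eqxx.
move=> A; rewrite inE => /andP[/eqP Ap nA]; case: eqP => // eR; case/eqP: nA.
by apply: ofs_inj; rewrite oA0; have [] := split_cat A Ap eR.
Qed.

(** The conditions on pairs of positions say that the letters of [w] and the block index order the
    positions alike. Positivity stays separate because variables are numbered from 1, while [wc]
    ignores the actual size of letters. *)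
Lemma Mser_wc u w : Mser (wc u) w = (all (leq 1) w && (wc w == wc u))%:R.
Proof.
rewrite /Mser deg_wc; congr (nat_of_bool _)%:R.
have [sw|sw] /= := eqVneq (size w) (size u); last first.
  apply/esym/negbTE; rewrite negb_and; apply/orP; right.
  by apply: contra sw => /eqP/(congr1 deg); rewrite !deg_wc => ->.
congr (_ && _); apply/idP/eqP => [/allP H|ew].
  rewrite /wc sw; apply: Lev_order => x y xP yP.
  have io z : z \in range (size u) -> z \in iota 1 (size u).
    by rewrite mem_range mem_iota add1n ltnS.
  have cond x' y' (xP' : x' \in range (size u)) (yP' : y' \in range (size u)) :=
    andP (allP (H _ (io x' xP')) _ (io y' yP')).
  rewrite -(blk_Lev_lt (fun j => nth 0 u j.-1) xP yP) -/(wc u).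
  apply/idP/idP => [lxy|bxy]; last first.
    by have [_ /implyP] := cond x y xP yP; apply.
  have [/eqP e _] := cond x y xP yP; have [_ /implyP i] := cond y x yP xP.
  (* Distinct letters lie in distinct blocks, and the reverse order of the blocks would force the
     reverse order of the letters. *)
  rewrite ltn_neqAle -e neq_ltn lxy /= leqNgt; apply/negP => /i.
  by move/(ltn_trans lxy); rewrite ltnn.
apply/allP => x xP; apply/allP => y yP.
have io z : z \in iota 1 (size u) -> z \in range (size u).
  by rewrite mem_range mem_iota add1n ltnS.
have lt x' y' : x' \in iota 1 (size u) -> y' \in iota 1 (size u) ->
    (blk (wc u) x' < blk (wc u) y')%N = (nth 0 w x'.-1 < nth 0 w y'.-1)%N.
  by move=> /io xP' /io yP'; rewrite -ew [wc w]/wc sw blk_Lev_lt.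
rewrite lt // implybb andbT; apply/eqP.
by rewrite -[LHS]negbK -[RHS]negbK !neq_ltn !lt.
Qed.

Lemma Mser_comp P w : is_comp P -> Mser P w = (all (leq 1) w && (wc w == P))%:R.
Proof. by move=> /comp_wc[u ->]; apply: Mser_wc. Qed.

Lemma size_wc_leq u : (size (wc u) <= size u)%N.
Proof.
rewrite size_map size_sort (leq_trans (size_undup _)) // size_map.
by rewrite -[X in (_ <= X)%N](card_range (size u)).
Qed.

Lemma tcomp_inj n k : injective (@tcomp n k).
Proof. by move=> s t /(inj_map (@ofs_inj n)) /val_inj. Qed.

(** Only the composition [wc w] contributes on the right, with the coefficient of [(P, Q)] in its
    coproduct. On the left each way to cut [w] tests its pieces against [P] and [Q], which computes
    the same coefficient. *)
Lemma series_mul_Mser P Q w : is_comp P -> is_comp Q ->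
  series_mul (Mser P) (Mser Q) w =
  \sum_(k < (deg P + deg Q).+1)
    \sum_(t : k.-tuple {set 'I_(deg P + deg Q)} | Comp (deg P + deg Q) (tcomp t))
      coef (cop_bar (tcomp t)) (P, Q) * Mser (tcomp t) w.
Proof.
move=> cP cQ; set n := (deg P + deg Q)%N.
have -> : series_mul (Mser P) (Mser Q) w = coef (cop_bar (wc w)) (P, Q) * (all (leq 1) w)%:R.
  rewrite coef_ev ev_cop_bar /series_mul /cuts big_map mulr_suml.
  rewrite -(big_mkord xpredT (fun i => Mser P (take i w) * Mser Q (drop i w))).
  rewrite /index_iota subn0; apply: eq_bigr => i _ /=.
  rewrite !Mser_comp // -!natrM !mulnb xpair_eqE -[in RHS](cat_take_drop i w).
  by rewrite all_cat cat_take_drop [in RHS]andbC andbACA.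
(* For a word of the wrong length both sides vanish: the pieces of a cut have the total length of
   [w], and every composition in the sum has degree [n]. *)
have [sw|sw] := eqVneq (size w) n; last first.
  rewrite coef_ev ev_cop_bar [X in X * _]big_seq big1 ?mul0r.
    rewrite big1 // => k _; rewrite big1 // => t ct.
    rewrite Mser_comp ?(Comp_is_comp ct) //; case: eqP => [e|_]; last by rewrite andbF mulr0.
    by move: sw; rewrite -deg_wc e (Comp_deg ct) eqxx.
  move=> _ /mapP[i _ ->] /=; case: eqP => // -[e1 e2]; move: sw.
  by rewrite /n -e1 -e2 !deg_wc -size_cat cat_take_drop eqxx.
have cw : Comp n (wc w) by rewrite -sw; apply: Comp_wc.
have kn : (size (wc w) < n.+1)%N by rewrite ltnS -sw size_wc_leq.
pose t0 : (size (wc w)).-tuple {set 'I_n} := map_tuple (pre_ofs n) (in_tuple (wc w)).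
have et0 : tcomp t0 = wc w.
  rewrite /tcomp /= -map_comp -[RHS]map_id; apply/eq_in_map => B Bw /=.
  apply: ofs_preK; rewrite -(setcomp_ground cw); apply/fsubsetP => x xB.
  by apply/groundP; exists B.
rewrite (bigD1 (Ordinal kn)) //= [X in _ + X]big1 ?addr0.
  rewrite (bigD1 t0) /= ?et0 // [X in _ + X]big1 ?addr0.
    by rewrite Mser_comp ?(Comp_is_comp cw) // eqxx andbT.
  move=> t /andP[ct /eqP tt0]; rewrite Mser_comp ?(Comp_is_comp ct) //.
  case: eqP => [e|_]; last by rewrite andbF mulr0.
  by case: tt0; apply: tcomp_inj; exact: etrans (esym e) (esym et0).
move=> k /eqP kk; rewrite big1 // => t ct; rewrite Mser_comp ?(Comp_is_comp ct) //.
case: eqP => [e|_]; last by rewrite andbF mulr0.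
by case: kk; apply: val_inj; rewrite /= e size_map size_tuple.
Qed.

Theorem theorem2p8 :
  (* (1) (T, overline-ast, hat-delta) is a graded connected cocommutative Hopf algebra *)
  (is_graded_connected_hopf cmul_bar cop_hat /\ is_cocommutative cop_hat) /\
  (* (2) (T, hat-ast, overline-delta) is a graded connected Hopf algebra ... *)
  (is_graded_connected_hopf cmul_hat cop_bar /\
  (* ... and P |-> W_P is an isomorphism onto NCQsym^* : *)
  (* the product of NCQsym^* (dual to the coproduct of NCQsym) corresponds to hat-ast:
     <W_P W_Q, M_R> = <W_P ⊗ W_Q, Delta M_R> is the coefficient of R in P hat-ast Q *)
   (forall P Q R, is_comp P -> is_comp Q -> is_comp R ->
      coef (cmul_hat P Q) R = coef (copNCQ R) (P, Q)) /\
  (* the coproduct of NCQsym^* (dual to the product of series) corresponds to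
     overline-delta: M_P M_Q = sum_{R in Comp_{p+q}} <overline-delta R, P ⊗ Q> M_R,
     an identity of formal power series *)
   (forall P Q, is_comp P -> is_comp Q ->
      forall w : seq nat,
        series_mul (Mser P) (Mser Q) w =
        \sum_(k < (deg P + deg Q).+1)
          \sum_(t : k.-tuple {set 'I_(deg P + deg Q)} | Comp (deg P + deg Q) (tcomp t))
            coef (cop_bar (tcomp t)) (P, Q) * Mser (tcomp t) w)).
Proof.
split; first by split; [apply: hopf_bar_hat | apply: cop_hat_cocommutative].
split; first exact: hopf_hat_bar.
split; first exact: coef_cmul_hat.
by move=> P Q cP cQ w; apply: series_mul_Mser.
Qed.
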